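(* For each $k\in\mathbb{N}$ the operators $\mathbf{D}_{k}^{w}$ and $\mathbf{H}_{w}$ commute, i.e. $$\mathbf{D}_{k}^{w}\mathbf{H}_{w}=\mathbf{H}_{w}\mathbf{D}_{k}^{w}.$$
   Context: Here $\mathbb{N}=\{1,2,\dots\}$. The Hardy-type operator $\mathbf{H}_{w}$ is defined by $$\mathbf{H}_{w}f(x)=\frac{1}{w_1(x)}\int_{\alpha}^{x}w(t)f(t)\,dt,\qquad x>0,$$ where $-\infty\le\alpha\le\infty$, $w_1(x)=\int_{\alpha}^{x}w(t)\,dt$, and $w,f$ are real measurable, locally integrable functions. The generalized weighted differential operator $\mathbf{D}_{k}^{w}$ of order $k$ is given by $$\mathbf{D}_{k}^{w}f(x)=\left(\frac{w_1(x)}{w(x)}\frac{d}{dx}\right)^{k}f(x)=\left(\frac{w_1(x)}{w(x)}\frac{d}{dx}\right)^{k-1}\left(\frac{w_1(x)}{w(x)}f'(x)\right),\qquad k=1,2,\dots,$$ with the same $w$, $\alpha$ and $w_1$. Two operators $P,Q$ are said to commute if $PQ=QP$. *)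

(* Defs.v *)
From HB Require Import structures.
From mathcomp Require Import all_boot all_order all_algebra.
From mathcomp Require Import all_classical all_reals all_analysis.

Set Implicit Arguments.
Unset Strict Implicit.
Unset Printing Implicit Defensive.

Import Order.TTheory GRing.Theory Num.Theory.
Import numFieldNormedType.Exports.

Local Open Scope classical_set_scope.
Local Open Scope ring_scope.

(* The open interval with end points alpha and x, in whichever order. *)
Definition between (R : realType) (alpha : \bar R) (x : R) : set R :=
  [set t | (alpha < t%:E < x%:E)%E \/ (x%:E < t%:E < alpha)%E].

(* The oriented integral of h from alpha to x; negative when x < alpha. *)
Definition oriented_int (R : realType) (alpha : \bar R) (h : R -> R) (x : R)
    : R :=
  if (alpha <= x%:E)%E
  then \int[lebesgue_measure]_(t in between alpha x) h t
  else - \int[lebesgue_measure]_(t in between alpha x) h t.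

Definition primitive1 (R : realType) (alpha : \bar R) (w : R -> R) : R -> R :=
  oriented_int alpha w.

Definition hardy (R : realType) (alpha : \bar R) (w f : R -> R) : R -> R :=
  fun x => (primitive1 alpha w x)^-1
           * oriented_int alpha (fun t => w t * f t) x.

(* Where f has to be defined for H_w f(x) to make sense for every x > 0:
   it contains ]alpha, 0] when alpha < 0, and omits the point alpha. *)
Definition source (R : realType) (alpha : \bar R) : set R :=
  \bigcup_(x in [set x : R | 0 < x]) between alpha x.

(* Where H_w f lives: w_1 vanishes at x = alpha. *)
Definition target (R : realType) (alpha : \bar R) : set R :=
  [set x : R | 0 < x /\ x%:E <> alpha].

(* What it takes for w_1, 1 / w_1 and w_1 / w to make sense. Integrability is
   that of Lebesgue and includes measurability; it is required up to alpha. *)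
Definition weight (R : realType) (alpha : \bar R) (w : R -> R) : Prop :=
  [/\ forall x, 0 < x ->
        lebesgue_measure.-integrable (between alpha x) (EFin \o w),
      forall x, target alpha x -> primitive1 alpha w x != 0
    & {ae lebesgue_measure, forall x, source alpha x -> w x != 0}].

Definition hardy_domain (R : realType) (alpha : \bar R) (w f : R -> R) : Prop :=
  forall x, 0 < x ->
    lebesgue_measure.-integrable (between alpha x)
      (EFin \o (fun t => w t * f t)).

Definition abs_continuous (R : realType) (a b : R) (f : R -> R) : Prop :=
  forall e : R, 0 < e -> exists2 d : R, 0 < d &
    forall (n : nat) (s t : 'I_n -> R),
      (forall i, a <= s i /\ s i <= t i /\ t i <= b) ->
      trivIset setT (fun i => [set x | s i < x < t i]) ->
      \sum_i (t i - s i) < d -> \sum_i `|f (t i) - f (s i)| < e.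

Definition locally_abs_continuous (R : realType) (X : set R) (f : R -> R)
    : Prop :=
  forall a b, [set x | a <= x <= b] `<=` X -> abs_continuous a b f.

(* g = (w_1 / w) f' on X. As w is only measurable, the derivative is that of a
   locally absolutely continuous function and the equation holds almost
   everywhere, so g is determined up to a null set. *)
Definition is_wdiff (R : realType) (alpha : \bar R) (w : R -> R) (X : set R)
    (f g : R -> R) : Prop :=
  locally_abs_continuous X f /\
  {ae lebesgue_measure, forall x, X x ->
     derivable f x 1 /\ g x = primitive1 alpha w x / w x * derive1 f x}.

(* The graph of the (unbounded) operator D_k^w = ((w_1 / w) d/dx)^k on X, with
   D_k^w f = D_{k-1}^w ((w_1 / w) f'). The intermediate function h may be taken
   to be any representative of its class, hence the locally absolutely
   continuous one when there is one. *)
Fixpoint is_wdiffn (R : realType) (alpha : \bar R) (w : R -> R) (X : set R)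
    (k : nat) (f g : R -> R) : Prop :=
  if k is j.+1
  then exists2 h, is_wdiff alpha w X f h & is_wdiffn alpha w X j h g
  else ae_eq lebesgue_measure X f g.

(* Main.v *)
(* Write w_1 for the primitive of w and phi_0 = f, phi_1, ..., phi_k = g for
   the iterates D^j f. The computation D (H f) = f - H f gives on the target
     D^j (H f) = (-1)^j (H f - sum_(i < j) (-1)^i phi_i),
   so everything reduces to the identity
     w_1 sum_(j < k) (-1)^j phi_j = int w phi_0 - (-1)^k int w phi_k,
   whose derivative is a telescoping sum; the point is that the constant of
   integration is 0 although phi_1, ..., phi_(k-1) are not controlled near
   alpha. To see this, replace w_1 by G_0(w_1), where G_0(y) = y kappa(y) and
   kappa vanishes for y^2 <= d, and w_1 in the j-th term by the iterate
   (y d/dy)^(k-1-j) G_0 at w_1. The sum still telescopes, and now vanishes near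
   alpha because w_1 tends to 0 there, so the fundamental theorem of calculus
   for absolutely continuous functions holds with no boundary term. The iterates
   divided by y are bounded uniformly in d and tend to 1, so d -> 0 is an
   application of dominated convergence to w f and w g only. *)
Require Import Defs.
From HB Require Import structures.
From mathcomp Require Import all_boot all_order all_algebra.
From mathcomp Require Import all_classical all_reals all_analysis.
From mathcomp Require Import measurable_realfun.
From mathcomp Require Import ring lra.

Set Implicit Arguments.
Unset Strict Implicit.
Unset Printing Implicit Defensive.

Import Order.TTheory GRing.Theory Num.Theory.
Import numFieldNormedType.Exports.

Local Open Scope classical_set_scope.
Local Open Scope ring_scope.

(** * Absolute continuity on a segment: first consequences and a domination criterion *)

Section absolute_continuity.
Context {R : realType}.
Implicit Types (f g : R -> R) (X : set R) (a b x : R).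
Notation mu := (@lebesgue_measure R).

(** Induction along a segment, used in place of compactness. The step takes [u] left of [c] and [v]
    right of it, so that at the supremum of the points reached, one application starts from a
    reached point and moves beyond. *)
Lemma interval_induction (P : R -> Prop) a b : a <= b -> P a ->
  (forall c, a <= c <= b -> exists2 r, 0 < r &
     forall u v, a <= u <= c -> c <= v <= b -> c - r < u -> v < c + r ->
     P u -> P v) ->
  P b.
Proof.
move=> ab Pa step; pose S := [set x | a <= x <= b /\ P x].
have Sa : S a by split=> //; rewrite lexx.
have hS : has_sup S.
  by split; [exists a | exists b => x [/andP[_ +] _]].
have sb : sup S <= b by apply: ge_sup; [exists a | move=> x [/andP[_ +] _]].
have as_ : a <= sup S by apply: sup_upper_bound.
have [|r r0 stp] := step (sup S); first by rewrite as_.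
have [u [/andP[au ub] Pu] us] := sup_adherent r0 hS.
have us' : u <= sup S by apply: sup_upper_bound => //; split=> //; rewrite au.
(* This point is past [sup S] unless the minimum is [b]; the comparison with [sup S] below thus
   leaves only [b <= sup S], where the point is [b] itself. *)
have vs : sup S <= Num.min b (sup S + r / 2) by rewrite le_min sb lerDl; lra.
have Pv : P (Num.min b (sup S + r / 2)).
  apply: (stp u) => //; first by rewrite au.
    by rewrite vs ge_min lexx.
  by rewrite gt_min; apply/orP; right; lra.
have : Num.min b (sup S + r / 2) <= sup S.
  apply: sup_upper_bound => //; split=> //.
  by rewrite (le_trans as_ vs) ge_min lexx.
rewrite ge_min => /orP[bs|]; last by lra.
by move: Pv; rewrite min_l //; lra.
Qed.

Lemma abs_continuous_unif a b f : abs_continuous a b f ->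
  forall e, 0 < e -> exists2 d, 0 < d & forall s t, a <= s -> s <= t -> t <= b ->
    t - s < d -> `|f t - f s| < e.
Proof.
move=> acf e e0; have [d d0 H] := acf _ e0; exists d => // s t as_ st tb tsd.
have := H 1 (fun=> s) (fun=> t); rewrite !big_ord1; apply=> //.
by apply/trivIsetP => i j _ _; rewrite !ord1 eqxx.
Qed.

Lemma abs_continuous_dist a b f : abs_continuous a b f ->
  forall e, 0 < e -> exists2 d, 0 < d & forall s t, a <= s <= b -> a <= t <= b ->
    `|t - s| < d -> `|f t - f s| < e.
Proof.
move=> acf e e0; have [d d0 H] := abs_continuous_unif acf e0; exists d => //.
move=> s t /andP[as_ sb] /andP[at_ tb]; rewrite ltr_norml => /andP[std tsd].
have [st|ts] := leP s t; first exact: H.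
by rewrite distrC H// ?ltW//; lra.
Qed.

Lemma abs_continuous_continuous a b f x : abs_continuous a b f -> a < x < b ->
  {for x, continuous f}.
Proof.
move=> acf /andP[ax xb]; apply/cvgrPdist_lt => e e0.
have [d d0 H] := abs_continuous_dist acf e0.
near=> t; rewrite distrC; apply: H; first by rewrite !ltW.
  by apply/andP; split; apply: ltW; near: t; [exact: lt_nbhsr|exact: lt_nbhsl].
by rewrite distrC; near: t; apply: cvgr_dist_lt.
Unshelve. all: by end_near. Qed.

Lemma abs_continuous_bounded a b f : abs_continuous a b f ->
  exists2 M, 0 < M & forall x, a <= x <= b -> `|f x| <= M.
Proof.
move=> acf; have [ab|ba] := leP a b; last first.
  by exists 1 => // x /andP[ax xb]; lra.
have [d d0 H] := abs_continuous_dist acf ltr01.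
suff [M HM] : exists M, forall x, a <= x <= b -> `|f x| <= M.
  exists (Num.max M 1); first by rewrite lt_max ltr01 orbT.
  by move=> x xab; rewrite le_max HM.
apply: (@interval_induction (fun y => exists M, forall x, a <= x <= y -> `|f x| <= M) _ _ ab).
  exists `|f a| => x; rewrite -eq_le => /eqP <-; exact: lexx.
move=> c /andP[ac cb]; exists d => // u v /andP[au uc] /andP[cv vb] cu vc [M HM].
exists (Num.max M (`|f c| + 1)) => x /andP[ax xv]; rewrite le_max.
have [xu|ux] := leP x u; first by rewrite HM ?ax.
apply/orP; right; rewrite -lerBlDl; apply: (le_trans (lerB_dist _ _)); apply: ltW.
apply: H; rewrite ?ac ?ax ?(le_trans xv)//.
by rewrite ltr_norml; apply/andP; split; lra.
Qed.

(** Closure under sums, products, inverses and Lipschitz maps all reduces to such a bound on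
    increments; a constant serves as [f2] when one function suffices. *)
Lemma abs_continuous_dominated a b f1 f2 g :
  abs_continuous a b f1 -> abs_continuous a b f2 ->
  (exists C, forall u v, a <= u -> u <= v -> v <= b ->
     `|g v - g u| <= C * (`|f1 v - f1 u| + `|f2 v - f2 u|)) ->
  abs_continuous a b g.
Proof.
move=> ac1 ac2 [C0 H] e e0.
pose C := Num.max C0 1; have C1 : 0 < C by rewrite lt_max ltr01 orbT.
have e1 : 0 < e / C / 2 by rewrite !divr_gt0.
have [d1 d10 H1] := ac1 _ e1; have [d2 d20 H2] := ac2 _ e1.
exists (Num.min d1 d2); first by rewrite lt_min d10.
move=> n s t st tr; rewrite lt_min => /andP[sd1 sd2].
have B1 := H1 n s t st tr sd1; have B2 := H2 n s t st tr sd2.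
apply: (@le_lt_trans _ _
  (C * (\sum_i `|f1 (t i) - f1 (s i)| + \sum_i `|f2 (t i) - f2 (s i)|))).
  rewrite -big_split mulr_sumr; apply: ler_sum => i _.
  have [asi [sti tbi]] := st i.
  by rewrite (le_trans (H _ _ _ _ _))// ler_wpM2r ?addr_ge0// le_max lexx.
rewrite -[X in _ < X](@divfK _ C) ?gt_eqF// mulrC ltr_pM2r//; lra.
Qed.

End absolute_continuity.

(** * Absolutely continuous functions whose derivative vanishes almost everywhere *)

Section zero_derivative.
Context {R : realType}.
Implicit Types (f g : R -> R) (a b x : R).
Notation mu := (@lebesgue_measure R).

Lemma is_derive0_small f x : is_derive x 1 f 0 -> forall e, 0 < e ->
  exists2 r, 0 < r & forall y, `|y - x| < r -> `|f y - f x| <= e * `|y - x|.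
Proof.
move=> [dfx Df0] e e0; move: (dfx) => /cvgrPdist_le /(_ _ e0).
rewrite -[lim _]/('D_1 f x) Df0 => /nbhs_ballP[r /= r0 H]; exists r => // y yxr.
have [->|yx] := eqVneq y x; first by rewrite !subrr normr0 mulr0.
have yx0 : y - x != 0 by rewrite subr_eq0.
have := H (y - x); rewrite /ball /= sub0r normrN => /(_ yxr yx0).
rewrite sub0r normrN [_ *: 1]mulr1 subrK /GRing.scale /= normrM normfV.
by rewrite mulrC ler_pdivrMr ?normr_gt0.
Qed.

Lemma sum_lengths_le n (s t : nat -> R) (U : set R) : measurable U ->
  (forall i, (i < n)%N -> s i <= t i /\ [set x | s i < x < t i] `<=` U) ->
  trivIset (fun i => (i < n)%N) (fun i => [set x | s i < x < t i]) ->
  ((\sum_(i < n) (t i - s i))%:E <= mu U)%E.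
Proof.
move=> mU sub tr.
(* Padding with [set0] from index [n] on makes the family disjoint over all of [nat]. *)
pose F i : set R := if (i < n)%N then [set` `]s i, t i[ ] else set0.
have FE i : (i < n)%N -> F i = [set x | s i < x < t i].
  by rewrite /F => ->; apply/seteqP; split=> x /=; rewrite in_itv.
have mF i : measurable (F i) by rewrite /F; case: ifP.
have trF : trivIset setT F.
  apply/trivIsetP => i j _ _ ij; rewrite {1}/F; case: ifPn => [jn|_]; last by rewrite set0I.
  rewrite /F; case: ifPn => [in_|_]; last by rewrite setI0.
  have := trivIsetP.1 tr i j jn in_ ij.
  by rewrite -!FE// /F jn in_.
have -> : (\sum_(i < n) (t i - s i))%:E = mu (\big[setU/set0]_(i < n) F i).
  rewrite measure_bigsetU// -sumEFin; apply: eq_bigr => i _.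
  have [sti _] := sub i (ltn_ord i).
  have -> : F i = [set` `]s i, t i[] by rewrite /F ltn_ord.
  transitivity (mu [set` `]s i, t i[]) => //; rewrite lebesgue_measure_itv /= lte_fin.
  move: sti; rewrite le_eqVlt => /predU1P[->|->]; last by rewrite EFinB.
  by rewrite ltxx subrr.
apply: le_measure; rewrite ?inE//; first by apply: bigsetU_measurable => i _; exact: mF.
move=> x; rewrite -bigcup_mkord => -[i /= ni Fx].
by have [_] := sub i ni; apply; rewrite -FE.
Qed.

(** Outer regularity, applied to a measurable null set [M] containing [N], bounds the measure of the
    part of [U] outside [M]; adding [M] back costs nothing. *)
Lemma null_set_open_cover (N : set R) (e : R) : 0 < e -> mu.-negligible N ->
  exists U, [/\ open U, N `<=` U & (mu U < e%:E)%E].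
Proof.
move=> e0 [M [mM M0' NM]]; have M0 : mu M = 0%E := M0'.
have Mfin : (mu M < +oo)%E by rewrite M0 ltry.
have [U [oU MU Ue]] := lebesgue_regularity_outer mM Mfin e0.
exists U; split=> //.
  exact: subset_trans NM MU.
have mU : measurable U by exact: open_measurable.
rewrite (_ : U = (U `\` M) `|` M); last by rewrite setUC setDUK.
rewrite measureU ?setDKI//; last exact: measurableD.
by rewrite -[X in (_ + X < _)%E]/(mu M) M0 adde0.
Qed.

(* A partition of [a, b] into short intervals either has increments bounded by
   e times the length, or lies in a small open set containing the points where
   the derivative is not 0, where absolute continuity applies. *)
Lemma abs_continuous_derive0 a b f : a <= b -> abs_continuous a b f ->
  {ae mu, forall x, a < x < b -> is_derive x 1 f 0} -> f b = f a.
Proof.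
move=> ab acf df; apply/eqP; rewrite -subr_eq0 -normr_le0.
apply/ler_addgt0Pl => e0 e00; rewrite addr0.
(* Chosen so that [e * (b - a) + e = e0]: one share for the points of small slope, one for the
   intervals inside [U]. *)
pose e := e0 / (b - a + 1).
have ba1 : 0 < b - a + 1 by lra.
have e_gt0 : 0 < e by rewrite divr_gt0.
have [d d0 acfd] := acf _ e_gt0.
(* The end points count as exceptional, since the derivative is known in the open interval only. *)
pose N := ~` [set x | a < x < b -> is_derive x 1 f 0] `|` ([set a] `|` [set b]).
have N0 : mu.-negligible N.
  apply: negligibleU => //.
  by apply: negligibleU; apply/negligibleP => //; exact: lebesgue_measure_set1.
have [U [oU NU Ud]] := null_set_open_cover d0 N0.
(* The recorded intervals are those placed inside [U]; over the rest of [[a, x]] the increments cost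
   at most [e] times the length. *)
pose P x := exists n (s t : nat -> R), [/\
  forall i, (i < n)%N -> [/\ a <= s i, s i <= t i, t i <= x & [set x | s i < x < t i] `<=` U],
  trivIset (fun i => (i < n)%N) (fun i => [set x | s i < x < t i]) &
  `|f x - f a| <= e * (x - a) + \sum_(i < n) `|f (t i) - f (s i)|].
suff [n [s [t [st tr le_f]]]] : P b.
  have : \sum_(i < n) `|f (t i) - f (s i)| < e.
    apply: acfd.
    - by move=> i; have [? ? ? _] := st i (ltn_ord i).
    - by apply/trivIsetP => i j _ _ ij; apply: (trivIsetP.1 tr); rewrite /= ?ltn_ord.
    - rewrite -lte_fin; apply: le_lt_trans Ud; apply: sum_lengths_le => //.
        exact: open_measurable.
      by move=> i /st[].
  have : e * (b - a) + e = e0 by rewrite /e; field; lra.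
  lra.
apply: (interval_induction ab).
  exists 0, (fun=> 0), (fun=> 0); split=> //.
  by rewrite !subrr normr0 mulr0 big_ord0 addr0.
move=> c /andP[ac cb].
have [Nc|Nc] := pselect (N c).
  (* Around an exceptional point, []u, v[] lies in [U] and is appended as the last interval. *)
  have := oU c (NU _ Nc) => /nbhs_ballP[r /= r0 rU]; exists r => //.
  move=> u v /andP[au uc] /andP[cv vb] cu vc [n [s [t [st tr le_f]]]].
  exists n.+1, (fun i => if i == n then u else s i), (fun i => if i == n then v else t i).
  have uvU : [set x | u < x < v] `<=` U.
    by move=> x /= /andP[ux xv]; apply: rU; rewrite /ball /= ltr_norml; lra.
  split.
  - move=> i; rewrite ltnS leq_eqVlt; case: eqP => [-> _|_ /= /st[? ? tu ?]].
      by split=> //; apply: le_trans cv.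
    by split=> //; rewrite (le_trans tu)// (le_trans uc).
  - have disj i : (i < n)%N -> [set x | s i < x < t i] `&` [set x | u < x < v] = set0.
      move=> /st[_ _ tu _]; apply/seteqP; split=> // x /= [/andP[_ xt] /andP[ux _]].
      by move: (lt_le_trans xt tu); rewrite ltNge ltW.
    apply/trivIsetP => i j /=; rewrite [(i < _)%N]ltnS [(i <= _)%N]leq_eqVlt.
    rewrite [(j < _)%N]ltnS [(j <= _)%N]leq_eqVlt.
    case: (eqVneq i n) => [->|ni /=]; case: (eqVneq j n) => [->|nj /=].
    + by move=> _ _; rewrite ?eqxx.
    + by move=> _ jn _; rewrite setIC; exact: disj.
    + by move=> in_ _ _; exact: disj.
    + by move=> in_ jn ij; exact: (trivIsetP.1 tr).
  - rewrite big_ord_recr /= eqxx.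
    under eq_bigr => i _ do rewrite (ltn_eqF (ltn_ord i)).
    have : e * (u - a) <= e * (v - a) by rewrite ler_pM2l//; lra.
    have : `|f v - f a| <= `|f v - f u| + `|f u - f a| by exact: ler_distD.
    lra.
have [acb dfc] : a < c < b /\ is_derive c 1 f 0.
  have acb : a < c < b.
    rewrite !lt_neqAle ac cb !andbT; apply/andP; split; apply/eqP => E; apply: Nc.
      by right; left.
    by right; right.
  by split=> //; apply: contrapT => ndf; apply: Nc; left => /(_ acb).
(* Around a point with derivative 0 no interval is added: the increment from [u] to [v] is at most
   [e * (v - u)]. *)
have [r r0 H] := is_derive0_small dfc e_gt0; exists r => //.
move=> u v /andP[au uc] /andP[cv vb] cu vc [n [s [t [st tr le_f]]]].
exists n, s, t; split=> //.
  by move=> i /st[? ? tu ?]; split=> //; rewrite (le_trans tu)// (le_trans uc).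
have fv : `|f v - f c| <= e * (v - c).
  by have := H v; rewrite ger0_norm ?subr_ge0//; apply; lra.
have fu : `|f u - f c| <= e * (c - u).
  by have := H u; rewrite ler0_norm ?subr_le0// opprB; apply; lra.
have : `|f v - f u| <= `|f v - f c| + `|f c - f u| by exact: ler_distD.
have : `|f v - f a| <= `|f v - f u| + `|f u - f a| by exact: ler_distD.
rewrite [`|f c - _|]distrC; lra.
Qed.

End zero_derivative.

(** * Algebra of absolutely continuous functions *)

Section absolute_continuity_algebra.
Context {R : realType} (a b : R).
Implicit Types (f g : R -> R) (e c L : R).

Lemma eq_abs_continuous f g : f =1 g -> abs_continuous a b f -> abs_continuous a b g.
Proof. by move=> /funext ->. Qed.

Lemma abs_continuous_cst c : abs_continuous a b (fun=> c : R).
Proof.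
move=> e e0; exists 1 => // n s t _ _ _.
by under eq_bigr do rewrite subrr normr0; rewrite sumr_const mul0rn.
Qed.

Lemma abs_continuousD f g : abs_continuous a b f -> abs_continuous a b g ->
  abs_continuous a b (fun x => f x + g x).
Proof.
move=> acf acg; apply: (abs_continuous_dominated acf acg); exists 1 => u v _ _ _.
rewrite mul1r (_ : f v + g v - _ = (f v - f u) + (g v - g u)); last by ring.
exact: ler_normD.
Qed.

Lemma abs_continuousM f g : abs_continuous a b f -> abs_continuous a b g ->
  abs_continuous a b (fun x => f x * g x).
Proof.
move=> acf acg; apply: (abs_continuous_dominated acf acg).
have [M M0 HM] := abs_continuous_bounded acf.
have [N N0 HN] := abs_continuous_bounded acg.
exists (M + N) => u v au uv vb.
rewrite (_ : f v * g v - _ = f v * (g v - g u) + g u * (f v - f u)); last by ring.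
rewrite (le_trans (ler_normD _ _))// !normrM.
have fv := HM v; have gu := HN u; rewrite (le_trans au uv) vb in fv.
rewrite au (le_trans uv vb) in gu.
rewrite mulrDr [leRHS]addrC lerD// ler_wpM2r//.
  by rewrite (le_trans (fv _))// lerDl ltW.
by rewrite (le_trans (gu _))// lerDr ltW.
Qed.

Lemma abs_continuousZ c f : abs_continuous a b f ->
  abs_continuous a b (fun x => c * f x).
Proof. by move=> acf; apply: abs_continuousM => //; exact: abs_continuous_cst. Qed.

Lemma abs_continuousB f g : abs_continuous a b f -> abs_continuous a b g ->
  abs_continuous a b (fun x => f x - g x).
Proof.
move=> acf acg; apply: eq_abs_continuous (abs_continuousD acf (abs_continuousZ (-1) acg)) => x.
by rewrite mulN1r.
Qed.

Lemma abs_continuousX n f : abs_continuous a b f ->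
  abs_continuous a b (fun x => f x ^+ n).
Proof.
move=> acf; elim: n => [|n IH]; first exact: abs_continuous_cst.
by apply: eq_abs_continuous (abs_continuousM acf IH) => x; rewrite exprS.
Qed.

Lemma abs_continuous_sum n (F : nat -> R -> R) :
  (forall i, (i < n)%N -> abs_continuous a b (F i)) ->
  abs_continuous a b (fun x => \sum_(i < n) F i x).
Proof.
elim: n => [|n IH] acF.
  by apply: eq_abs_continuous (abs_continuous_cst 0) => x; rewrite big_ord0.
apply: (@eq_abs_continuous (fun x => \sum_(i < n) F i x + F n x)).
  by move=> x; rewrite big_ord_recr.
by apply: abs_continuousD; [apply: IH => i ni; apply: acF; exact: ltnW|exact: acF].
Qed.

Lemma abs_continuous_horner (p : {poly R}) f : abs_continuous a b f ->
  abs_continuous a b (fun x => p.[f x]).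
Proof.
move=> acf; elim/poly_ind: p => [|p c IH].
  by apply: eq_abs_continuous (abs_continuous_cst 0) => x; rewrite horner0.
apply: (@eq_abs_continuous (fun x => p.[f x] * f x + c)).
  by move=> x; rewrite hornerMXaddC.
by apply: abs_continuousD; [exact: abs_continuousM|exact: abs_continuous_cst].
Qed.

Lemma abs_continuous_lipschitz L (phi : R -> R) f :
  (forall y z, `|phi z - phi y| <= L * `|z - y|) ->
  abs_continuous a b f -> abs_continuous a b (fun x => phi (f x)).
Proof.
move=> lip acf; apply: (abs_continuous_dominated acf (abs_continuous_cst 0)).
by exists L => u v _ _ _; rewrite subrr normr0 addr0.
Qed.

Lemma abs_continuousV e f : 0 < e -> (forall x, a <= x <= b -> e <= `|f x|) ->
  abs_continuous a b f -> abs_continuous a b (fun x => (f x)^-1).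
Proof.
move=> e0 ef acf; apply: (abs_continuous_dominated acf (abs_continuous_cst 0)).
exists (e * e)^-1 => u v au uv vb; rewrite subrr normr0 addr0.
have fu : e <= `|f u| by rewrite ef// au (le_trans uv).
have fv : e <= `|f v| by rewrite ef// vb andbT (le_trans au).
have fu0 : f u != 0 by rewrite -normr_gt0 (lt_le_trans e0).
have fv0 : f v != 0 by rewrite -normr_gt0 (lt_le_trans e0).
rewrite (_ : (f v)^-1 - _ = (f u - f v) / (f u * f v)); last by field; rewrite fv0 fu0.
rewrite normrM mulrC distrC normfV ler_wpM2r// lef_pV2 ?posrE.
- by rewrite normrM ler_pM// ltW.
- by rewrite normr_gt0 mulf_neq0.
- exact: mulr_gt0.
Qed.

End absolute_continuity_algebra.

(** * Primitives of functions integrable on the whole line *)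

Section lebesgue_primitive.
Context {R : realType}.
Implicit Types (f g h : R -> R) (a b x e d : R).
Notation mu := (@lebesgue_measure R).

(** The base point [-oo] suits an [h] integrable on the line; other integrands are first cut off
    outside a segment. *)
Definition lebesgue_primitive h x : R := \int[mu]_(t in `]-oo, x]) h t.

Lemma lebesgue_primitiveB h u v : mu.-integrable setT (EFin \o h) -> u <= v ->
  lebesgue_primitive h v - lebesgue_primitive h u = \int[mu]_(t in `]u, v]) h t.
Proof.
move=> ih uv; rewrite /lebesgue_primitive Rintegral_itvB//.
exact: integrableS ih.
Qed.

(** The integral of [|h|] over a set is small when the measure of the set is; here the set is the
    union of the given intervals. *)
Lemma abs_continuous_lebesgue_primitive h a b : mu.-integrable setT (EFin \o h) ->
  abs_continuous a b (lebesgue_primitive h).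
Proof.
move=> ih e e0; have [d [d0 H]] := integral_normr_continuous ih e0.
exists d => // n s t st tr sd.
(* The families over ['I_n] are extended to [nat]; the default value 0 is masked by [set0] in
   [F]. *)
pose s' i := if insub i is Some j then s j else 0.
pose t' i := if insub i is Some j then t j else 0.
have s'E (i : 'I_n) : s' i = s i by rewrite /s' valK.
have t'E (i : 'I_n) : t' i = t i by rewrite /t' valK.
pose F i : set R := if (i < n)%N then [set` `]s' i, t' i[ ] else set0.
have FE (i : 'I_n) : F i = [set x | s i < x < t i].
  by rewrite /F ltn_ord s'E t'E; apply/seteqP; split=> x /=; rewrite in_itv.
have mF i : measurable (F i) by rewrite /F; case: ifP.
have trF : trivIset setT F.
  apply/trivIsetP => i j _ _ ij; rewrite /F; case: ifPn => [in_|_]; last by rewrite set0I.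
  case: ifPn => [jn|_]; last by rewrite setI0.
  have := trivIsetP.1 tr (Ordinal in_) (Ordinal jn) I I; rewrite -val_eqE /= => /(_ ij).
  by rewrite -!FE /F /= in_ jn.
have mA : measurable (\big[setU/set0]_(i < n) F i).
  by apply: bigsetU_measurable => i _; exact: mF.
have muF (i : 'I_n) : mu (F i) = (t i - s i)%:E.
  have [_ [sti _]] := st i.
  have -> : F i = [set` `]s i, t i[] by rewrite /F ltn_ord s'E t'E.
  transitivity (mu [set` `]s i, t i[]) => //; rewrite lebesgue_measure_itv /= lte_fin.
  move: sti; rewrite le_eqVlt => /predU1P[->|->]; last by rewrite EFinB.
  by rewrite ltxx subrr.
have iA : mu.-integrable (\big[setU/set0]_(i < n) F i) (EFin \o (fun x => `|h x|)).
  by apply: integrableS (integrable_norm ih).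
have iF (i : 'I_n) : mu.-integrable (F i) (EFin \o (fun x => `|h x|)).
  by apply: integrableS (integrable_norm ih) => //; exact: mF.
apply: le_lt_trans (H _ mA _); last first.
  rewrite measure_bigsetU// (eq_bigr (fun i => (t i - s i)%:E)) => [|i _]; last exact: muF.
  by rewrite sumEFin lte_fin.
have -> : \int[mu]_(x in \big[setU/set0]_(i < n) F i) `|h x| =
   \sum_(i < n) \int[mu]_(x in F i) `|h x|.
  rewrite /Rintegral integral_bigsetU_EFin//.
  - rewrite (eq_bigr (fun i : 'I_n => (\int[mu]_(x in F i) `|h x|)%:E)) ?sumEFin// => i _.
    by rewrite /Rintegral fineK//; apply: integrable_fin_num (iF i); exact: mF.
  - by move=> i; exact: mF.
  - exact: index_enum_uniq.
  - by apply/trivIsetP => i j _ _ ij; rewrite !FE; exact: (trivIsetP.1 tr).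
  - exact: measurable_int iA.
apply: ler_sum => i _; have [_ [sti _]] := st i.
rewrite lebesgue_primitiveB// -Rintegral_itv_bndo_bndc; last exact: integrableS ih.
rewrite /F ltn_ord s'E t'E; apply: le_normr_Rintegral => //; exact: integrableS ih.
Qed.

End lebesgue_primitive.

(** * The fundamental theorem of calculus for absolutely continuous functions *)

Section fundamental_theorem.
Context {R : realType}.
Implicit Types (f g h : R -> R) (a b x : R).
Notation mu := (@lebesgue_measure R).

Lemma is_derive_lebesgue_primitive h : mu.-integrable setT (EFin \o h) ->
  {ae mu, forall x, is_derive x 1 (lebesgue_primitive h) (h x)}.
Proof.
move=> ih; have := @FTC1Ny R h; rewrite /=.
have i1 y : mu.-integrable `]-oo, y] (EFin \o h) by exact: integrableS ih.
have i2 : locally_integrable [set: R] h.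
  by apply: open_integrable_locally => //; exact: openT.
move=> /(_ i1 i2); apply: filterS; first exact: (ae_filter_ringOfSetsType mu).
move=> x [dh h1].
by split; [exact: dh|rewrite -derive1E; exact: h1].
Qed.

(** Subtracting from [f] the primitive of [g] cut off outside []a, b[] leaves an absolutely
    continuous function with derivative 0 almost everywhere, hence with equal values at [a] and
    [b]. *)
Lemma abs_continuous_FTC f g a b : a <= b -> abs_continuous a b f ->
  mu.-integrable `]a, b[ (EFin \o g) ->
  {ae mu, forall x, a < x < b -> is_derive x 1 f (g x)} ->
  \int[mu]_(x in `]a, b[) g x = f b - f a.
Proof.
move=> ab acf ig df; pose h := g \_ `]a, b[.
have ih : mu.-integrable setT (EFin \o h).
  by rewrite -restrict_EFin; apply/integrable_restrict => //=; rewrite setTI.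
have : f b - lebesgue_primitive h b = f a - lebesgue_primitive h a.
  apply: (abs_continuous_derive0 ab (f := fun x => f x - lebesgue_primitive h x)).
    by apply: abs_continuousB => //; exact: abs_continuous_lebesgue_primitive.
  have := is_derive_lebesgue_primitive ih; move: df.
  apply: filterS2; first exact: (ae_filter_ringOfSetsType mu).
  move=> x df dh axb.
  have -> : 0 = g x - h x.
    by rewrite /h patchE mem_set ?subrr//= in_itv.
  by apply: is_deriveB => //; exact: df.
have := lebesgue_primitiveB ih ab.
rewrite -Rintegral_itv_bndo_bndc; last exact: integrableS ih.
rewrite [X in _ = X](_ : _ = \int[mu]_(x in `]a, b[) g x); first by lra.
by apply: eq_Rintegral => x xab; rewrite /h patchE xab.
Qed.

End fundamental_theorem.

(** * The intervals between [alpha] and a point *)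

Section between_points.
Context {R : realType} (alpha : \bar R).
Implicit Types (h : R -> R) (a b t u v x : R).
Notation mu := (@lebesgue_measure R).

Lemma betweenE_lt x : (alpha <= x%:E)%E ->
  between alpha x = [set t | (alpha < t%:E)%E && (t < x)].
Proof.
move=> ax; apply/seteqP; split => t; rewrite /between /= -?lte_fin; last by left.
by case=> // /andP[xt ta]; move: (lt_trans xt ta); rewrite ltNge ax.
Qed.

Lemma betweenE_gt x : (x%:E < alpha)%E ->
  between alpha x = [set t | (x < t) && (t%:E < alpha)%E].
Proof.
move=> xa; apply/seteqP; split => t; rewrite /between /= -?lte_fin; last by right.
by case=> // /andP[ta xt]; move: (lt_trans xa (lt_trans ta xt)); rewrite ltxx.
Qed.

Lemma between_itv x : exists i : interval R,
  between alpha x = [set` i] /\ open [set` i].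
Proof.
have [ax|xa] := leP alpha x%:E.
  rewrite betweenE_lt//; case: alpha ax => [a _||_].
  - exists `]a, x[; split; last exact: interval_open.
    by apply/seteqP; split=> t /=; rewrite in_itv/= lte_fin.
  - by rewrite leye_eq.
  - exists `]-oo, x[; split; last exact: interval_open.
    by apply/seteqP; split=> t /=; rewrite in_itv/= ltNyr.
rewrite betweenE_gt//; case: alpha xa => [a _|_|].
- exists `]x, a[; split; last exact: interval_open.
  by apply/seteqP; split=> t /=; rewrite in_itv/= lte_fin.
- exists `]x, +oo[; split; last exact: interval_open.
  by apply/seteqP; split=> t /=; rewrite in_itv/= ltry.
- by rewrite ltNge leNye.
Qed.

Lemma open_between x : open (between alpha x).
Proof. by have [i [-> ]] := between_itv x. Qed.

Lemma measurable_between x : measurable (between alpha x).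
Proof. by have [i [-> _]] := between_itv x. Qed.

Lemma between_neq x t : between alpha x t -> t%:E != alpha.
Proof. by case=> /andP[]; [move=> /gt_eqF-> //|move=> _ /lt_eqF ->]. Qed.

Lemma subset_between x t : between alpha x t -> between alpha t `<=` between alpha x.
Proof.
case=> /andP[at_ tx] s [/andP[as_ st]|/andP[ts sa]].
- by left; rewrite as_ (lt_trans st).
- by move: (lt_trans at_ (lt_trans ts sa)); rewrite ltxx.
- by move: (lt_trans as_ (lt_trans st tx)); rewrite ltxx.
- by right; rewrite sa andbT (lt_trans at_).
Qed.

(** A sequence running into [alpha] from the side of [x]. The second clause expresses convergence to
    [alpha] uniformly in the finite and infinite cases. *)
Lemma between_seq x : x%:E != alpha -> exists2 a : nat -> R,
  forall n, between alpha x (a n) &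
  forall t, t%:E != alpha -> \forall n \near \oo, ~ between alpha (a n) t.
Proof.
rewrite neq_lt; case: alpha => [r| |].
(* With [n.+2] instead of [n.+1], already [a 0] differs from [x], as the open interval requires. *)
- pose a n : R := r + (x - r) / n.+2%:R.
  have n2 n : 1 < n.+2%:R :> R by rewrite ltr1n.
  have n20 n : 0 < n.+2%:R :> R by rewrite ltr0n.
  have cvg_a : a n @[n --> \oo] --> r.
    rewrite -[X in _ --> X]addr0 -(mulr0 (x - r)); apply: cvgD; first exact: cvg_cst.
    apply: cvgM; first exact: cvg_cst.
    by have := @cvg_harmonic R; rewrite -cvg_shiftS.
  move=> xr; exists a.
    move=> n; move: xr; rewrite /between /a /= !lte_fin => /orP[xr|rx]; [right|left].
      rewrite -subr_gt0 (_ : _ - _ = (r - x) * (1 - n.+2%:R^-1)); last by ring.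
      rewrite mulr_gt0 ?subr_gt0 ?invf_lt1//= gtrDl pmulr_llt0 ?invr_gt0//; lra.
    rewrite ltrDl divr_gt0 ?subr_gt0//=.
    rewrite -subr_gt0 (_ : _ - _ = (x - r) * (1 - n.+2%:R^-1)); last by ring.
    by rewrite mulr_gt0 ?subr_gt0 ?invf_lt1.
  move=> t tr; have tr0 : 0 < `|t - r| by rewrite normr_gt0 subr_eq0.
  have /cvgrPdist_lt/(_ _ tr0) := cvg_a; apply: filterS => n.
  rewrite distrC => an; rewrite /between /= !lte_fin => -[/andP[rt ta]|/andP[at_ tr']].
    by move: an; rewrite !ger0_norm; lra.
  by move: an; rewrite !ler0_norm; lra.
- move=> _; exists (fun n => x + n.+1%:R).
    by move=> n; right; rewrite lte_fin ltrDl ltr0n ltry.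
  move=> t _; near=> n => -[/andP[]|/andP[]]; first by rewrite ltNge leey.
  rewrite lte_fin => + _; apply/negP; rewrite -leNgt -lerBlDl.
  rewrite (@le_trans _ _ n%:R)// ?ler_nat//.
  by near: n; exact: nbhs_infty_ger.
- move=> _; exists (fun n => x - n.+1%:R).
    by move=> n; left; rewrite lte_fin ltNyr gtrBl ltr0n.
  move=> t _; near=> n => -[/andP[]|/andP[]]; last by move=> _; rewrite ltNge leNye.
  rewrite lte_fin => _; apply/negP; rewrite -leNgt lerBlDr -lerBlDl.
  rewrite (@le_trans _ _ n%:R)// ?ler_nat//.
  by near: n; exact: nbhs_infty_ger.
Unshelve. all: by end_near. Qed.

(** The segment lies on one side of [alpha], so both values come from the same branch of
    [oriented_int] and the larger domain splits. *)
Lemma oriented_intB h a b : a <= b -> (alpha < a%:E \/ b%:E < alpha)%E ->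
  mu.-integrable (between alpha a) (EFin \o h) ->
  mu.-integrable (between alpha b) (EFin \o h) ->
  oriented_int alpha h b - oriented_int alpha h a = \int[mu]_(t in `]a, b[) h t.
Proof.
move=> ab; rewrite /oriented_int => -[aa|ba] ia ib.
  have ba : (alpha < b%:E)%E by rewrite (lt_le_trans aa).
  rewrite !ltW//.
  have E : between alpha b = between alpha a `|` `[a, b[%classic.
    rewrite !betweenE_lt ?ltW//; apply/seteqP; split => t /=; rewrite in_itv /=.
      by move=> /andP[-> ->]; case: leP => _; [right|left].
    case=> [/andP[-> /= /lt_le_trans->]//|/andP[at_ ->]].
    by rewrite andbT (lt_le_trans aa).
  rewrite E Rintegral_setU//; last 3 first.
  - exact: measurable_between.
  - by rewrite -E.
  - apply/disj_setPS => t [/=]; rewrite betweenE_lt ?ltW//= in_itv /= => /andP[_ ta] /andP[at_ _].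
    by move: ta; rewrite ltNge at_.
  rewrite addrC addKr -Rintegral_itv_obnd_cbnd//.
  apply: integrableS ib => //; first exact: measurable_between.
  rewrite E => t /=; rewrite !in_itv /= => /andP[at_ ->]; right.
  by rewrite ltW.
have aa : (a%:E < alpha)%E by rewrite (le_lt_trans _ ba).
rewrite [(alpha <= a%:E)%E]leNgt [(alpha <= b%:E)%E]leNgt aa ba.
(* Left of [alpha] the larger domain belongs to [a]; the minus signs of [oriented_int] restore the
   order. *)
have E : between alpha a = `]a, b]%classic `|` between alpha b.
  rewrite !betweenE_gt//; apply/seteqP; split => t /=; rewrite in_itv /=.
    by move=> /andP[-> ->]; rewrite andbT; case: leP => _; [left|right].
  case=> [/andP[-> /= tb]|/andP[bt ->]]; first by rewrite (le_lt_trans _ ba).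
  by rewrite andbT (le_lt_trans ab).
rewrite E (@Rintegral_setU _ _ _ mu `]a, b]%classic)//; last 3 first.
- exact: measurable_between.
- by rewrite -E.
- apply/disj_setPS => t [/=]; rewrite betweenE_gt//= in_itv /= => /andP[_ tb] /andP[bt _].
  by move: bt; rewrite ltNge tb.
rewrite opprK addrC addrK -Rintegral_itv_bndo_bndc//.
apply: integrableS ia => //; first exact: measurable_between.
rewrite E => t /=; rewrite !in_itv /= => /andP[-> tb]; left.
by rewrite ltW.
Qed.

End between_points.

(** Each point of [X] is interior to a segment with rational end points contained in [X], and there
    are countably many of these. *)
Lemma ae_open {R : realType} (X : set R) (Q : R -> Prop) : open X ->
  (forall a b : R, a < b -> [set x | a <= x <= b] `<=` X ->
    {ae lebesgue_measure, forall x, a < x < b -> Q x}) ->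
  {ae lebesgue_measure, forall x, X x -> Q x}.
Proof.
move=> oX H.
pose I (n : nat) : option (R * R) :=
  if @unpickle (rat * rat)%type n is Some (p, q) then
    if (ratr p < ratr q :> R) && `[< [set x : R | ratr p <= x <= ratr q] `<=` X >]
    then Some (ratr p, ratr q) else None
  else None.
have : {ae lebesgue_measure, forall (x : R) n,
    if I n is Some (p, q) then p < x < q -> Q x else True}.
  apply: ae_foralln => n; case E : (I n) => [[p q]|]; last exact: aeW.
  move: E; rewrite /I; case: unpickle => // -[p' q']; case: ifP => // /andP[pq /asboolP sub].
  by case=> <- <-; exact: H.
apply: filterS; first exact: (ae_filter_ringOfSetsType lebesgue_measure).
move=> x Hx Xx; have /nbhs_ballP[e /= e0 eX] := oX x Xx.
have xe : x - e < x by rewrite gtrBl.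
have ex : x < x + e by rewrite ltrDl.
have [p] := rat_in_itvoo xe; have [q] := rat_in_itvoo ex.
rewrite !in_itv /= => /andP[xq qe] /andP[ep px].
have := Hx (pickle (p, q)); rewrite /I pickleK (lt_trans px xq) /=.
case: asboolP => [_|[]]; first by apply; rewrite px.
move=> y /= /andP[py yq]; apply: eX; rewrite /ball /= ltr_norml; lra.
Qed.

(** * Oriented integrals as functions of their end point *)

Section oriented_integral.
Context {R : realType} (alpha : \bar R).
Implicit Types (h f g : R -> R) (X : set R) (a b t u v x : R).
Notation mu := (@lebesgue_measure R).

Lemma segment_avoid a b : a <= b -> (forall t, a <= t <= b -> t%:E != alpha) ->
  (alpha < a%:E \/ b%:E < alpha)%E.
Proof.
move=> ab H; case: alpha H => [r| |] H; rewrite ?lte_fin; last 2 first.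
- by right; rewrite ltry.
- by left; rewrite ltNyr.
have [ra|ar] := ltP r a; first by left.
have [br|rb] := ltP b r; first by right.
by have := H r; rewrite ar rb eqxx => /(_ isT).
Qed.

Section local.
Variables (X : set R) (h : R -> R).
Hypothesis Xalpha : forall x, X x -> x%:E != alpha.
Hypothesis ih : forall x, X x -> mu.-integrable (between alpha x) (EFin \o h).

Lemma integrable_segment a b : a <= b -> [set x | a <= x <= b] `<=` X ->
  mu.-integrable `]a, b[ (EFin \o h).
Proof.
move=> ab abX; have [|aa|ba] := @segment_avoid a b ab.
- by move=> t tab; exact/Xalpha/abX.
- have Xe : X b by apply: abX; rewrite /= ab lexx.
  apply: integrableS (ih Xe) => //; first exact: measurable_between.
  rewrite betweenE_lt ?ltW ?(lt_le_trans aa)// => t /=; rewrite in_itv /= => /andP[at_ ->].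
  by rewrite andbT (lt_trans aa).
- have Xe : X a by apply: abX; rewrite /= ab lexx.
  apply: integrableS (ih Xe) => //; first exact: measurable_between.
  rewrite betweenE_gt ?(le_lt_trans _ ba)// => t /=; rewrite in_itv /= => /andP[-> tb].
  by rewrite (lt_trans _ ba).
Qed.

Lemma integrable_patch_segment a b : a <= b -> [set x | a <= x <= b] `<=` X ->
  mu.-integrable setT (EFin \o (h \_ `]a, b[)).
Proof.
move=> ab abX; rewrite -restrict_EFin; apply/integrable_restrict => //=.
by rewrite setTI; exact: integrable_segment.
Qed.

(** On a segment avoiding [alpha] the oriented integral is an ordinary primitive up to a constant,
    so absolute continuity and the almost everywhere derivative carry over. *)
Lemma oriented_int_primitiveB a b u v : a <= u -> u <= v -> v <= b ->
  [set x | a <= x <= b] `<=` X ->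
  oriented_int alpha h v - oriented_int alpha h u =
  lebesgue_primitive (h \_ `]a, b[) v - lebesgue_primitive (h \_ `]a, b[) u.
Proof.
move=> au uv vb abX.
have ab : a <= b by rewrite (le_trans au) ?(le_trans uv).
have ip := integrable_patch_segment ab abX.
rewrite lebesgue_primitiveB// oriented_intB//; last 3 first.
- apply: segment_avoid => // t /andP[ut tv]; apply/Xalpha/abX => /=.
  by rewrite (le_trans au) ?(le_trans tv).
- by apply/ih/abX => /=; rewrite au (le_trans uv).
- by apply/ih/abX => /=; rewrite vb (le_trans au).
rewrite -Rintegral_itv_bndo_bndc; last exact: integrableS ip.
apply: eq_Rintegral => t; rewrite inE /= in_itv /= => /andP[ut tv].
by rewrite patchE mem_set//= in_itv /= (le_lt_trans au) ?(lt_le_trans tv).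
Qed.

Lemma locally_abs_continuous_oriented_int :
  locally_abs_continuous X (oriented_int alpha h).
Proof.
move=> a b abX; have [ab|ba] := leP a b; last first.
  (* The segment is empty, which forces [n = 0]. *)
  move=> e e0; exists 1 => // -[|n] s t st _ _; first by rewrite big_ord0.
  by have [as_ [s0t tb]] := st ord0; have := le_trans as_ (le_trans s0t tb); rewrite leNgt ba.
have := abs_continuous_lebesgue_primitive a b (integrable_patch_segment ab abX).
move=> acp; apply: (abs_continuous_dominated acp acp); exists 1 => u v au uv vb.
by rewrite mul1r (oriented_int_primitiveB au uv vb abX) lerDl.
Qed.

Lemma is_derive_oriented_int : open X ->
  {ae mu, forall x, X x -> is_derive x 1 (oriented_int alpha h) (h x)}.
Proof.
move=> oX; apply: ae_open => // a b ab abX.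
have := is_derive_lebesgue_primitive (integrable_patch_segment (ltW ab) abX).
apply: filterS; first exact: (ae_filter_ringOfSetsType mu).
move=> x + /andP[ax xb].
rewrite patchE mem_set /= ?in_itv /= ?ax// => dp.
set p := lebesgue_primitive _ in dp.
apply: (near_eq_is_derive (f := fun t => p t + (oriented_int alpha h a - p a))).
  near=> t.
  have at_ : a <= t by apply: ltW; near: t; exact: lt_nbhsr.
  have tb : t <= b by apply: ltW; near: t; exact: lt_nbhsl.
  have := oriented_int_primitiveB (lexx a) at_ tb abX; rewrite -/p; lra.
rewrite -[h x]addr0; apply: is_deriveD.
Unshelve. all: by end_near. Qed.

End local.

(** Absolute continuity is asked between [a] and [x], hence away from [alpha]; [Num.min] and
    [Num.max] cover both sides of [alpha]. *)
Lemma oriented_int_FTC f h a x : x%:E != alpha -> between alpha x a ->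
  abs_continuous (Num.min a x) (Num.max a x) f ->
  mu.-integrable (between alpha x) (EFin \o h) ->
  {ae mu, forall t, between alpha x t -> is_derive t 1 f (h t)} ->
  oriented_int alpha h x - oriented_int alpha h a = f x - f a.
Proof.
move=> xalpha axa acf ih df.
have ia : mu.-integrable (between alpha a) (EFin \o h).
  by apply: integrableS ih; [exact: measurable_between..|exact: subset_between].
have sub u v : u <= v -> [set t | u < t < v] `<=` between alpha x ->
    mu.-integrable `]u, v[ (EFin \o h) /\
    {ae mu, forall t, u < t < v -> is_derive t 1 f (h t)}.
  move=> uv sub; split.
    by apply: integrableS ih => //; exact: measurable_between.
  move: df; apply: filterS; first exact: (ae_filter_ringOfSetsType mu).
  by move=> t + utv; apply; exact: sub.
case: axa => /andP[].
  move=> aa; rewrite lte_fin => ax.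
  move: acf; rewrite min_l ?max_r ?ltW// => acf.
  have [|i d] := sub a x (ltW ax).
    by move=> t /andP[at_ tx]; left; rewrite (lt_trans aa).
  rewrite (oriented_intB (ltW ax) (or_introl aa) ia ih).
  exact: abs_continuous_FTC (ltW ax) acf i d.
rewrite lte_fin => xa aa.
move: acf; rewrite min_r ?max_l ?ltW// => acf.
have [|i d] := sub x a (ltW xa).
  by move=> t /andP[xt ta]; right; rewrite lte_fin xt (lt_trans _ aa).
apply: oppr_inj; rewrite !opprB (oriented_intB (ltW xa) (or_intror aa) ih ia).
exact: abs_continuous_FTC (ltW xa) acf i d.
Qed.

Lemma oriented_int0 h x : (forall t, between alpha x t -> h t = 0) ->
  oriented_int alpha h x = 0.
Proof.
move=> h0; rewrite /oriented_int (@eq_Rintegral _ _ _ _ _ (cst 0)).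
  by rewrite /Rintegral integral0 /= oppr0 if_same.
by move=> t /[!inE]; exact: h0.
Qed.

Lemma normr_oriented_int h x :
  `|oriented_int alpha h x| = `|\int[mu]_(t in between alpha x) h t|.
Proof. by rewrite /oriented_int; case: ifP => // _; rewrite normrN. Qed.

End oriented_integral.

(** * A piecewise polynomial cutoff and its iterates *)

Section cutoff.
Context {R : realType}.
Implicit Types (v : R) (m i : nat).

(** The threshold 1/2 for [v = y^2 / (y^2 + d)] corresponds to [y^2 = d]. *)
Definition ramp v : R := Num.max 0 (v - 2^-1).

Lemma is_derive_sqr_ramp v : is_derive v 1 (fun v => ramp v ^+ 2) (2 * ramp v).
Proof.
(* The quadratic remainder bound also holds at the corner [v = 2^-1], which is what squaring the
   ramp achieves. *)
have bound h : `|ramp (h + v) ^+ 2 - ramp v ^+ 2 - 2 * ramp v * h| <= h ^+ 2.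
  rewrite /ramp ler_norml.
  by case: (lerP 0 (v - 2^-1)); case: (lerP 0 (h + v - 2^-1)); nra.
have cvgd : h^-1 *: (ramp (h *: 1 + v) ^+ 2 - ramp v ^+ 2) @[h --> 0^'] --> 2 * ramp v.
  apply/cvgrPdist_le => e e0; apply/nbhs_ballP; exists e => //= h.
  rewrite /ball /= sub0r normrN => he h0.
  rewrite distrC [h *: 1]mulr1 /GRing.scale /=.
  rewrite (_ : _ - _ =
    h^-1 * (ramp (h + v) ^+ 2 - ramp v ^+ 2 - 2 * ramp v * h)); last by field.
  rewrite normrM normfV (le_trans _ (ltW he))// mulrC ler_pdivrMr ?normr_gt0//.
  by rewrite -expr2 real_normK ?num_real.
split; first by apply/cvg_ex; eexists; exact: cvgd.
exact/cvg_lim/cvgd.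
Qed.

(** One ramp factor may be traded for the polynomial [v - 2^-1]: where the two differ, the remaining
    positive power vanishes. *)
Lemma ramp_exprS n v : (0 < n)%N -> ramp v ^+ n.+1 = ramp v ^+ n * (v - 2^-1).
Proof.
case: n => // n _; rewrite exprSr !exprSr -!mulrA; congr (_ * _).
by rewrite /ramp; case: (lerP 0 (v - 2^-1)) => // _; rewrite !mul0r.
Qed.

Lemma is_derive_ramp_exp n v : (1 < n)%N ->
  is_derive v 1 (fun v => ramp v ^+ n) (n%:R * ramp v ^+ n.-1).
Proof.
elim: n => // -[|[|n]] IH // _; first exact: is_derive_sqr_ramp.
have -> : (fun v => ramp v ^+ n.+3) = (fun v => ramp v ^+ n.+2) * (fun v => v - 2^-1).
  by apply/funext => y; rewrite ramp_exprS.
have d1 := IH isT.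
have d2 : is_derive v 1 (fun v => v - 2^-1 : R) 1.
  by rewrite -[X in is_derive _ _ _ X]subr0; apply: is_deriveB.
apply: is_derive_eq; rewrite /GRing.scale /= mulr1.
rewrite mulrCA [(v - _) * _]mulrC -ramp_exprS//.
rewrite -[n.+3%:R]natr1; ring.
Qed.

(* cutoff m i.+1 is obtained from kappa = cutoff m i by kappa + 2 v (1 - v)
   kappa', that is, (y d/dy) (y kappa) divided by y, where v = y^2 / (y^2 + d);
   each step costs one power of the ramp, so cutoff m i is of class C^1 for
   i.+1 < m. *)
Fixpoint cutoff_coef m i : {poly R} :=
  if i is j.+1 then
    let q := cutoff_coef m j in
    q * ('X - (2^-1)%:P) +
    2%:P * 'X * (1 - 'X) * (q^`() * ('X - (2^-1)%:P) + (m - j)%:R%:P * q)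
  else (2 ^+ m)%:P.

Definition cutoff m i v : R := (cutoff_coef m i).[v] * ramp v ^+ (m - i).

Lemma cutoff_eq0 m i v : (i < m)%N -> v <= 2^-1 -> cutoff m i v = 0.
Proof.
move=> im v2; rewrite /cutoff /ramp max_l; last by lra.
by rewrite expr0n subn_eq0 leqNgt im mulr0.
Qed.

(** At [v = 1] the factor [1 - 'X] kills the derivative term, so each step halves the coefficient
    while the ramp loses one factor 1/2. The initial [2 ^+ m] normalises the product. *)
Lemma cutoff1 m i : (i <= m)%N -> cutoff m i 1 = 1.
Proof.
move=> im; rewrite /cutoff.
have -> : ramp 1 = 2^-1 by rewrite /ramp max_r; lra.
suff -> : (cutoff_coef m i).[1] = 2 ^+ (m - i).
  by rewrite -exprMn mulfV ?expr1n//.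
elim: i im => [|i IH] im; first by rewrite subn0 /= hornerC.
rewrite /= !hornerE /= subrr mulr0 mul0r addr0 IH; last exact: ltnW.
by rewrite -(subnSK im) exprS; field.
Qed.

(** The factor [2 v (1 - v)] is [y dv/dy] for [v = y^2 / (y^2 + d)]. The condition on [i] leaves a
    ramp exponent of at least 2, hence differentiability at the corner. *)
Lemma is_derive_cutoff m i v : (i.+1 < m)%N ->
  exists2 d, is_derive v 1 (cutoff m i) d &
    2 * v * (1 - v) * d = cutoff m i.+1 v - cutoff m i v.
Proof.
move=> im; set q := cutoff_coef m i.
have mi : (1 < m - i)%N by rewrite ltn_subRL addn1.
have d1 := is_derive_ramp_exp v mi.
have d2 : is_derive v 1 (fun v => q.[v]) q^`().[v] by exact: is_derive_poly.
exists (q.[v] * ((m - i)%:R * ramp v ^+ (m - i).-1) + ramp v ^+ (m - i) * q^`().[v]).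
  have -> : cutoff m i = (fun v => q.[v]) * (fun v => ramp v ^+ (m - i)).
    by apply/funext.
  exact: is_deriveM.
rewrite /cutoff /= -/q subnS.
have E : ramp v ^+ (m - i) = ramp v ^+ (m - i).-1 * (v - 2^-1).
  by case: (m - i)%N mi => // -[|n] _ //; rewrite ramp_exprS.
by rewrite E !hornerE /=; ring.
Qed.

Lemma abs_continuous_cutoff m i (a b : R) f : abs_continuous a b f ->
  abs_continuous a b (fun x => cutoff m i (f x)).
Proof.
move=> acf; apply: abs_continuousM; first exact: abs_continuous_horner.
apply: abs_continuousX; apply: (abs_continuous_lipschitz (L := 1)) acf => y z.
rewrite mul1r /ramp ler_norml.
have := ler_norm (z - y); have := ler_norm (y - z); rewrite [`|y - z|]distrC.
by case: (lerP 0 (z - 2^-1)); case: (lerP 0 (y - 2^-1)); lra.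
Qed.

Lemma abs_continuous_id (a b : R) : abs_continuous a b id.
Proof.
move=> e e0; exists e => // n s t st _; apply: le_lt_trans; apply: ler_sum => i _.
by rewrite ger0_norm// subr_ge0; have [_ []] := st i.
Qed.

Lemma continuous_cutoff m i : continuous (cutoff m i).
Proof.
move=> v; apply: (@abs_continuous_continuous _ (v - 1) (v + 1)); last by lra.
by apply: abs_continuous_cutoff; exact: abs_continuous_id.
Qed.

Lemma cutoff_bounded m i : exists2 M, 0 < M &
  forall v, 0 <= v <= 1 -> `|cutoff m i v| <= M.
Proof.
by apply: abs_continuous_bounded; apply: abs_continuous_cutoff; exact: abs_continuous_id.
Qed.

End cutoff.

(** * Truncation near zero, with bounds uniform in the parameter *)

Section truncation.
Context {R : realType}.
Implicit Types (d y : R) (m i : nat).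

(** Maps the line into [[0, 1]] for every [d > 0], so a bound for [cutoff] on that segment is
    uniform in [d]. *)
Definition sqr_ratio d y : R := y ^+ 2 / (y ^+ 2 + d).

(** For [i < m], [y * truncation m i d y] is the [i]-th iterate of [y d/dy] on
    [y * truncation m 0 d y]. *)
Definition truncation m i d y : R := cutoff m i (sqr_ratio d y).

Lemma sqr_ratio_ge0_le1 d y : 0 < d -> 0 <= sqr_ratio d y <= 1.
Proof.
move=> d0; have y0 := sqr_ge0 y; have yd : 0 < y ^+ 2 + d by lra.
by rewrite /sqr_ratio divr_ge0 ?ler_pdivrMr//=; lra.
Qed.

Lemma is_derive_truncation m i d y : 0 < d -> (i.+1 < m)%N ->
  exists2 c, is_derive y 1 (truncation m i d) c &
    y * c = truncation m i.+1 d y - truncation m i d y.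
Proof.
move=> d0 im; have [c dc ec] := is_derive_cutoff (sqr_ratio d y) im.
have yd : y ^+ 2 + d != 0 by have := sqr_ge0 y; lra.
have d1 : is_derive y 1 (fun y : R => y ^+ 2) (2 * y).
  have -> : (fun y : R => y ^+ 2) = id * id by apply/funext => z; rewrite expr2.
  by apply: is_derive_eq; rewrite /GRing.scale /=; ring.
have d2 : is_derive y 1 (fun y : R => (y ^+ 2 + d)^-1) (- (y ^+ 2 + d) ^- 2 * (2 * y)).
  have d20 : is_derive y 1 (fun y : R => y ^+ 2 + d) (2 * y).
    by rewrite -[2 * y]addr0; exact: is_deriveD.
  exact: (@is_deriveV _ (fun y : R => y ^+ 2 + d) y (2 * y) 1 yd d20).
have d3 : is_derive y 1 (sqr_ratio d)
    (y ^+ 2 * (- (y ^+ 2 + d) ^- 2 * (2 * y)) + (y ^+ 2 + d)^-1 * (2 * y)).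
  exact: (is_deriveM d1 d2).
eexists; first exact: (is_derive1_comp dc d3).
rewrite -/(truncation m i.+1 d y) -/(truncation m i d y) in ec *.
rewrite -ec /sqr_ratio; field.
by rewrite yd.
Qed.

Lemma truncation_eq0 m i d y : 0 < d -> (i < m)%N -> y ^+ 2 <= d -> truncation m i d y = 0.
Proof.
move=> d0 im yd; apply: cutoff_eq0 => //; have := sqr_ge0 y => y0.
by rewrite /sqr_ratio ler_pdivrMr; lra.
Qed.

Lemma abs_continuous_truncation m i d (a b : R) f : 0 < d -> abs_continuous a b f ->
  abs_continuous a b (fun x => truncation m i d (f x)).
Proof.
move=> d0 acf; apply: abs_continuous_cutoff; apply: abs_continuousM.
  exact: abs_continuousX.
apply: (abs_continuousV d0).
  by move=> x _; rewrite ger0_norm; have := sqr_ge0 (f x); lra.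
by apply: abs_continuousD; [exact: abs_continuousX|exact: abs_continuous_cst].
Qed.

Lemma truncation_bounded m i : exists2 M, 0 < M &
  forall d y, 0 < d -> `|truncation m i d y| <= M.
Proof.
have [M M0 H] := @cutoff_bounded R m i; exists M => // d y d0.
by apply: H; exact: sqr_ratio_ge0_le1.
Qed.

(** For [y != 0] the ratio tends to 1 as [d] tends to 0, and [cutoff] is continuous with value 1
    there. *)
Lemma cvg_truncation m i y : (i <= m)%N -> y != 0 ->
  truncation m i n.+1%:R^-1 y @[n --> \oo] --> (1 : R).
Proof.
move=> im y0; have y20 : y ^+ 2 != 0 by rewrite expf_neq0.
have E : cutoff m i (y ^+ 2 / (y ^+ 2 + 0)) = 1 by rewrite addr0 mulfV// cutoff1.
rewrite -[X in _ --> X]E.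
apply: (@continuous_cvg _ _ _ _ _ _ (cutoff m i)); first exact: continuous_cutoff.
apply: cvgM; first exact: cvg_cst.
apply: cvgV; first by rewrite addr0.
by apply: cvgD; [exact: cvg_cst|exact: cvg_harmonic].
Qed.

Lemma continuous_truncation m i d : 0 < d -> continuous (truncation m i d).
Proof.
move=> d0 v; apply: (@abs_continuous_continuous _ (v - 1) (v + 1)); last by lra.
by apply: abs_continuous_truncation => //; exact: abs_continuous_id.
Qed.

End truncation.

(** * Dominated convergence and the decay of oriented integrals at [alpha] *)

Lemma Rintegral_dominated_cvg (R : realType) (D : set R) (f_ : nat -> R -> R)
    (f g : R -> R) (mu := @lebesgue_measure R) :
  measurable D -> (forall n, measurable_fun D (f_ n)) -> measurable_fun D f ->
  {ae mu, forall x, D x -> f_ n x @[n --> \oo] --> f x} ->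
  mu.-integrable D (EFin \o g) -> (forall n x, D x -> `|f_ n x| <= g x) ->
  \int[mu]_(x in D) f_ n x @[n --> \oo] --> \int[mu]_(x in D) f x.
Proof.
move=> mD mf_ mf f_f ig fg.
have [||||ifm _ cvg] := @dominated_convergence _ _ _ mu D mD
    (fun n => EFin \o f_ n) (EFin \o f) (EFin \o g) _ _ _ ig.
- by move=> n; apply/measurable_EFinP; exact: mf_.
- by apply/measurable_EFinP; exact: mf.
- move: f_f; apply: filterS; first exact: (ae_filter_ringOfSetsType mu).
  move=> x + Dx => /(_ Dx) => fx; apply/cvg_EFin; first exact: nearW.
  exact: fx.
- by apply: aeW => x n Dx /=; rewrite lee_fin fg.
apply: fine_cvg; rewrite fineK//; exact: integrable_fin_num.
Qed.

Section oriented_limits.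
Context {R : realType} (alpha : \bar R).
Implicit Types (h f g : R -> R) (a b t u v x : R).
Notation mu := (@lebesgue_measure R).

Lemma oriented_int_dominated_cvg (f_ : nat -> R -> R) f g x :
  let D := between alpha x in
  (forall n, measurable_fun D (f_ n)) -> measurable_fun D f ->
  {ae mu, forall t, D t -> f_ n t @[n --> \oo] --> f t} ->
  mu.-integrable D (EFin \o g) -> (forall n t, D t -> `|f_ n t| <= g t) ->
  oriented_int alpha (f_ n) x @[n --> \oo] --> oriented_int alpha f x.
Proof.
move=> D mf_ mf f_f ig fg.
have := Rintegral_dominated_cvg (measurable_between alpha x) mf_ mf f_f ig fg.
rewrite /oriented_int; case: ifP => // _; exact: cvgN.
Qed.

(** Along [between_seq], the restrictions of [|h|] to the shrinking intervals tend to 0 pointwise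
    and are dominated by [|h|]. For [h = w] this says that [w_1] tends to 0 at [alpha]. *)
Lemma oriented_int_small h x : x%:E != alpha ->
  mu.-integrable (between alpha x) (EFin \o h) ->
  forall e : R, 0 < e -> exists2 a, between alpha x a &
    forall t, between alpha a t \/ t = a -> `|oriented_int alpha h t| <= e.
Proof.
move=> xalpha ih e e0; have [a xa aalpha] := between_seq xalpha.
pose f_ n t := ((fun t => `|h t|) \_ (between alpha (a n))) t.
have mh : measurable_fun (between alpha x) h.
  by apply/measurable_EFinP; exact: measurable_int ih.
have inh := integrable_norm ih.
have : \int[mu]_(t in between alpha x) f_ n t @[n --> \oo] -->
       \int[mu]_(t in between alpha x) (cst 0 t : R).
  apply: (Rintegral_dominated_cvg (g := fun t => `|h t|)) => //.
  - exact: measurable_between.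
  - move=> n; apply/measurable_restrict; [exact: measurable_between..|].
    apply: measurableT_comp => //; apply: measurable_funS mh; first exact: measurable_between.
    exact: subIsetl.
  - apply: aeW => t xt; apply: cvg_near_cst.
    have := aalpha t (between_neq xt); apply: filterS => n nt.
    by rewrite /f_ patchE memNset.
  - move=> n t _; rewrite /f_ patchE; case: ifP => _; rewrite ?normr_id// normr0.
    exact: normr_ge0.
rewrite [X in _ --> X](_ : _ = 0); last by rewrite /Rintegral integral0.
move=> /cvgrPdist_le/(_ e e0)[n _ /(_ n (leqnn n))].
rewrite sub0r normrN => le_e; exists (a n) => // t ta.
have sub : between alpha t `<=` between alpha (a n).
  by case: ta => [|->//]; exact: subset_between.
have subx := subset_between (xa n).
apply: le_trans le_e; rewrite normr_oriented_int.
have mt := measurable_between alpha t; have ma := measurable_between alpha (a n).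
have it : mu.-integrable (between alpha t) (EFin \o h).
  apply: integrableS ih => //; first exact: measurable_between.
  exact: subset_trans subx.
apply: (le_trans (le_normr_Rintegral _ it)); first exact: mt.
apply: (le_trans _ (ler_norm _)); rewrite -Rintegral_mkcondr setIidr//.
rewrite /Rintegral fine_le//.
- by apply: integrable_fin_num => //; exact: integrable_norm.
- apply: integrable_fin_num => //; apply: integrable_norm.
  by apply: integrableS ih => //; exact: measurable_between.
apply: ge0_subset_integral => //.
by apply: measurable_int; apply: integrableS inh => //; exact: measurable_between.
Qed.

End oriented_limits.

Lemma locally_abs_continuous_continuous {R : realType} (X : set R) f x :
  open X -> locally_abs_continuous X f -> X x -> {for x, continuous f}.
Proof.
move=> oX acf Xx; have /nbhs_ballP[e /= e0 eX] := oX x Xx.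
apply: (@abs_continuous_continuous _ (x - e / 2) (x + e / 2)); last by lra.
by apply: acf => y /= xy; apply: eX; rewrite /ball /= ltr_norml; lra.
Qed.

(* The zeros of f where the derivative does not vanish are isolated. *)
Lemma ae_derive_neq0 {R : realType} (X : set R) (f df : R -> R) :
  {ae lebesgue_measure, forall x, X x -> is_derive x 1 f (df x)} ->
  {ae lebesgue_measure, forall x, X x -> df x != 0} ->
  {ae lebesgue_measure, forall x, X x -> f x != 0}.
Proof.
move=> dfX df0.
pose I n : set R := if @unpickle (rat * rat)%type n is Some (p, q)
  then [set x | ratr p < x < ratr q] else set0.
(* For each rational interval at most one [x] is its only zero, so the exceptional set is at most a
   singleton. *)
have : {ae lebesgue_measure, forall (x : R) n,
    ~ (I n x /\ forall s, I n s -> f s = 0 <-> s = x)}.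
  apply: ae_foralln => n.
  have [[x Hx]|H] := pselect (exists x, I n x /\ forall s, I n s -> f s = 0 <-> s = x).
    have [Ix fx] := Hx.
    exists [set x]; split=> //; first exact: lebesgue_measure_set1.
    move=> y /= /contrapT[Iy fy]; apply/(fx y Iy); exact/fy.
  by apply: aeW => x Hx; apply: H; exists x.
move: dfX df0; apply: filterS3; first exact: (ae_filter_ringOfSetsType lebesgue_measure).
move=> x dfx df0 isol Xx; apply/eqP => fx.
have [[dx Dx] d0] := (dfx Xx, df0 Xx).
have d00 : 0 < `|df x| by rewrite normr_gt0.
move: (dx) => /cvgrPdist_lt /(_ _ d00).
rewrite -[lim _]/('D_1 f x) Dx => /nbhs_ballP[r /= r0 H].
have xe : x - r < x by rewrite gtrBl.
have ex : x < x + r by rewrite ltrDl.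
have [p] := rat_in_itvoo xe; have [q] := rat_in_itvoo ex.
rewrite !in_itv /= => /andP[xq qe] /andP[ep px].
apply: (isol (pickle (p, q))); rewrite /I pickleK /=; split; first by rewrite px.
move=> s /andP[ps sq]; split=> [fs|->//]; apply: contrapT => /eqP sx.
(* A second zero [s] would give difference quotient 0, at distance [|df x|] from the derivative. *)
have sx0 : s - x != 0 by rewrite subr_eq0.
have := H (s - x); rewrite /ball /= sub0r normrN ltr_norml.
rewrite [_ *: 1]mulr1 subrK fs fx subrr scaler0 subr0 ltxx => /(_ _ sx0).
have -> : - r < s - x < r by lra.
by move=> /(_ isT).
Qed.

(** * The domains [source] and [target] *)

Section source_target.
Context {R : realType} (alpha : \bar R).
Implicit Types (f g h w : R -> R) (x t : R).
Notation mu := (@lebesgue_measure R).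

Lemma open_source : open (source alpha).
Proof. by apply: bigcup_open => x _; exact: open_between. Qed.

Lemma source_neq x : source alpha x -> x%:E != alpha.
Proof. by case=> y _; exact: between_neq. Qed.

Lemma subset_target_source : target alpha `<=` source alpha.
Proof.
move=> x [x0 /eqP]; rewrite neq_lt => /orP[xa|ax].
  exists (x / 2); first by rewrite /= divr_gt0.
  by right; rewrite xa lte_fin andbT; lra.
exists (x + 1); first by rewrite /=; lra.
by left; rewrite ax lte_fin; lra.
Qed.

Lemma open_target : open (target alpha).
Proof.
have -> : target alpha = [set x : R | 0 < x] `&` source alpha.
  apply/seteqP; split=> x; first by move=> tx; split; [case: tx|exact: subset_target_source].
  by case=> x0 /source_neq/eqP.
by apply: openI; [exact: open_gt|exact: open_source].
Qed.

Lemma source_integrable h :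
  (forall x, 0 < x -> mu.-integrable (between alpha x) (EFin \o h)) ->
  forall x, source alpha x -> mu.-integrable (between alpha x) (EFin \o h).
Proof.
move=> ih x [y y0 yx]; apply: integrableS (ih y y0); last exact: subset_between.
  exact: measurable_between.
exact: measurable_between.
Qed.

Lemma segment_source x a : 0 < x -> source alpha x -> between alpha x a ->
  [set t | Num.min a x <= t <= Num.max a x] `<=` source alpha.
Proof.
move=> x0 sx xa t /= tax.
have [->//|tx] := eqVneq t x; exists x => //.
case: xa tax => /andP[].
  move=> aa; rewrite lte_fin => ax.
  rewrite (min_l (ltW ax)) (max_r (ltW ax)) => /andP[at_ tx'].
  by left; rewrite (lt_le_trans aa)//= lte_fin lt_neqAle tx.
rewrite lte_fin => xa aa; rewrite (min_r (ltW xa)) (max_l (ltW xa)) => /andP[xt ta].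
by right; rewrite (le_lt_trans _ aa) ?lee_fin// lte_fin lt_neqAle eq_sym tx xt.
Qed.

End source_target.

(** * The alternating sum identity *)

Section alternating_sum.
Context {R : realType} (alpha : \bar R) (w : R -> R) (K : nat) (phi : nat -> R -> R).
Notation mu := (@lebesgue_measure R).
Notation W := (primitive1 alpha w).
Hypothesis hw : weight alpha w.
Hypothesis dphi : forall j, (j < K)%N ->
  is_wdiff alpha w (source alpha) (phi j) (phi j.+1).
Hypothesis i0 : hardy_domain alpha w (phi 0).
Hypothesis iK : hardy_domain alpha w (phi K).

(** The order [K.+1] exceeds every index from 0 to [K] that occurs, as vanishing near 0 and
    differentiability demand. *)
Let T i (d : R) t := truncation K.+1 i d (W t).

(** With index [K - j.+1], the [j]-th term has derivative [S j - S j.+1] almost everywhere, where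
    [S j = (-1)^j w T_(K-j) phi_j]. *)
Let B d t := \sum_(j < K) (-1) ^+ j * (W t * T (K - j.+1) d t * phi j t).

(** The two ends [S 0 - S K] of the telescoping derivative of [B d]. *)
Let beta d t := w t * phi 0 t * T K d t - (-1) ^+ K * (w t * phi K t * T 0 d t).

Lemma weight_locally_abs_continuous : locally_abs_continuous (source alpha) W.
Proof.
have [iw _ _] := hw; apply: locally_abs_continuous_oriented_int.
  exact: source_neq.
exact: source_integrable.
Qed.

Lemma weight_is_derive :
  {ae mu, forall x, source alpha x -> is_derive x 1 W (w x)}.
Proof.
have [iw _ _] := hw; apply: is_derive_oriented_int; last exact: open_source.
  exact: source_neq.
exact: source_integrable.
Qed.

(** [weight] gives [W x != 0] on the target, but the integrals may run through nonpositive points of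
    the source; there the derivative [w], nonzero almost everywhere, decides. *)
Lemma weight_ae_neq0 : {ae mu, forall x, source alpha x -> W x != 0}.
Proof.
by have [_ _ w0] := hw; exact: ae_derive_neq0 weight_is_derive w0.
Qed.

Let acB d : 0 < d -> locally_abs_continuous (source alpha) (B d).
Proof.
move=> d0 a b abs; have acW := weight_locally_abs_continuous abs.
apply: (@abs_continuous_sum _ _ _ K (fun j t =>
  (-1) ^+ j * (W t * T (K - j.+1) d t * phi j t))).
move=> j jK; apply: abs_continuousZ; apply: abs_continuousM.
  by apply: abs_continuousM => //; exact: abs_continuous_truncation.
by have [+ _] := dphi jK; apply.
Qed.

Lemma is_derive_mul_truncation m i (d y : R) : 0 < d -> (i.+1 < m)%N ->
  is_derive y 1 (fun y => y * truncation m i d y) (truncation m i.+1 d y).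
Proof.
move=> d0 im; have [c dc ec] := is_derive_truncation y d0 im.
have -> : (fun y => y * truncation m i d y) = id * truncation m i d by apply/funext.
apply: is_derive_eq; rewrite /GRing.scale /= mulr1 ec; ring.
Qed.

Let dB d : 0 < d ->
  {ae mu, forall t, source alpha t -> is_derive t 1 (B d) (beta d t)}.
Proof.
move=> d0.
(* One null set serves all [j] at once. *)
have dall : {ae mu, forall t (j : nat), (j < K)%N -> source alpha t ->
    derivable (phi j) t 1 /\ phi j.+1 t = W t / w t * derive1 (phi j) t}.
  apply: ae_foralln => j; have [jK|jK] := ltnP j K; last by apply: aeW.
  have [_] := dphi jK; apply: filterS; first exact: (ae_filter_ringOfSetsType mu).
  by move=> t H _; exact: H.
have [_ _ w0] := hw.
move: dall w0 weight_is_derive; apply: filterS3.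
  exact: (ae_filter_ringOfSetsType mu).
move=> t dall w0 dW st.
have {}w0 := w0 st; have {}dW := dW st.
have dterm (j : 'I_K) : is_derive t 1
    ((fun=> (-1) ^+ j) * ((fun t => W t * T (K - j.+1) d t) * phi j))
    (w t * ((-1) ^+ j * (T (K - j) d t * phi j t)) -
     w t * ((-1) ^+ j.+1 * (T (K - j.+1) d t * phi j.+1 t))).
  have [dj ej] := dall j (ltn_ord j) st.
  have im : ((K - j.+1).+1 < K.+1)%N by rewrite ltnS subnSK// leq_subr.
  have dG := is_derive_mul_truncation (W t) d0 im.
  have dGW := is_derive1_comp dG dW.
  rewrite subnSK// in dGW.
  have djP := derivableP dj.
  have dM := is_deriveM dGW djP.
  apply: (is_derive_eq (is_deriveM (is_derive_cst ((-1) ^+ j : R) t (1 : R)) dM)).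
  by rewrite /GRing.scale /= mulr0 addr0 /T exprS ej -derive1E; field.
have -> : B d = \sum_(j < K) ((fun=> (-1) ^+ j) * ((fun t => W t * T (K - j.+1) d t) * phi j)).
  by apply/funext => s; rewrite /B fct_sumE; apply: eq_bigr => j _ /=.
apply: (is_derive_eq (is_derive_sum dterm)).
pose S j := w t * ((-1) ^+ j * (T (K - j) d t * phi j t)).
have -> : \sum_(j < K) (S j - S j.+1) = - \sum_(0 <= j < K) (S j.+1 - S j).
  by rewrite big_mkord -sumrN; apply: eq_bigr => j _; rewrite opprB.
rewrite telescope_sumr// /S /beta subn0 subnn expr0; ring.
Qed.

Let cont_T i d x : 0 < d -> source alpha x -> {for x, continuous (T i d)}.
Proof.
move=> d0 sx; apply: continuous_comp; last exact: continuous_truncation.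
exact: locally_abs_continuous_continuous (@open_source _ _) weight_locally_abs_continuous sx.
Qed.

Variable x : R.
Hypothesis tx : target alpha x.
Let sub : between alpha x `<=` source alpha.
Proof. by move=> t xt; exists x => //; case: tx. Qed.

Let mT i d : 0 < d -> measurable_fun (between alpha x) (T i d).
Proof.
move=> d0; apply: open_continuous_measurable_fun; first exact: open_between.
by move=> t; rewrite inE => xt; apply: cont_T => //; exact: sub.
Qed.

Let ih0 : mu.-integrable (between alpha x) (EFin \o (fun t => w t * phi 0 t)).
Proof. by apply: i0; case: tx. Qed.

Let ihK : mu.-integrable (between alpha x) (EFin \o (fun t => w t * phi K t)).
Proof. by apply: iK; case: tx. Qed.

Let m0 : measurable_fun (between alpha x) (fun t => w t * phi 0 t).
Proof. by apply/measurable_EFinP; exact: measurable_int ih0. Qed.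

Let mK : measurable_fun (between alpha x) (fun t => w t * phi K t).
Proof. by apply/measurable_EFinP; exact: measurable_int ihK. Qed.

Let mbeta d : 0 < d -> measurable_fun (between alpha x) (beta d).
Proof.
move=> d0; apply: measurable_funB; first by apply: measurable_funM => //; exact: mT.
by apply: measurable_funM => //; apply: measurable_funM => //; exact: mT.
Qed.

(** Only the integrable functions [w phi_0] and [w phi_K] enter, with constants independent of
    [d]. *)
Let dominating : exists2 g : R -> R,
  mu.-integrable (between alpha x) (EFin \o g) &
  forall d t, 0 < d -> `|beta d t| <= g t.
Proof.
have [M0 M00 H0] := @truncation_bounded R K.+1 0.
have [MK MK0 HK] := @truncation_bounded R K.+1 K.
exists (fun t => MK * `|w t * phi 0 t| + M0 * `|w t * phi K t|).
  have mb : @measurable _ (measurableTypeR R) (between alpha x) by exact: measurable_between.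
  have := integrableD mb (integrableZl mb MK (integrable_norm ih0))
                         (integrableZl mb M0 (integrable_norm ihK)).
  by apply: eq_integrable => //.
move=> d t d0; rewrite /beta; apply: (le_trans (ler_normB _ _)); rewrite normrMsign.
rewrite [`|w t * phi 0 t * _|]normrM [`|w t * phi K t * _|]normrM.
by rewrite lerD// mulrC ler_wpM2r //; [exact: HK|exact: H0].
Qed.

Let ibeta d : 0 < d -> mu.-integrable (between alpha x) (EFin \o beta d).
Proof.
move=> d0; have [g ig Hg] := dominating.
apply: le_integrable ig; first exact: measurable_between.
  by apply/measurable_EFinP; exact: mbeta.
by move=> t _ /=; rewrite lee_fin (le_trans (Hg d t d0))// ler_norm.
Qed.

Let B_oriented d : 0 < d -> B d x = oriented_int alpha (beta d) x.
Proof.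
move=> d0; have sx := subset_target_source tx; have xa := source_neq sx.
have x0 : 0 < x by case: tx.
have [iw _ _] := hw.
(* [|W t| <= min d 1] yields [W t ^+ 2 <= d], the range where the truncation vanishes. *)
have e0 : 0 < Num.min d 1 by rewrite lt_min d0 ltr01.
have [a xa_ Ha] := oriented_int_small xa (iw x x0) e0.
have T0 i t : (i < K.+1)%N -> between alpha a t \/ t = a -> T i d t = 0.
  move=> iK1 ta; apply: truncation_eq0 => //.
  have := Ha t ta; rewrite le_min => /andP[Wd W1].
  rewrite -real_normK ?num_real// expr2 (le_trans _ Wd)// ler_piMr//.
have := oriented_int_FTC xa xa_ (acB d0 (segment_source x0 sx xa_)) (ibeta d0).
have Ba : B d a = 0.
  rewrite /B big1// => j _; rewrite T0 ?mulr0 ?mul0r ?mulr0//; last by right.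
  by rewrite ltnS leq_subr.
have -> : oriented_int alpha (beta d) a = 0.
  apply: oriented_int0 => t ta; rewrite /beta !T0 ?mulr0 ?subr0//; by left.
rewrite Ba !subr0 => <- //.
have := dB d0; apply: filterS; first exact: (ae_filter_ringOfSetsType mu).
by move=> t H xt; apply: H; exact: sub.
Qed.

(* The truncated boundary term vanishes near alpha, so that no information on
   the intermediate functions is needed there when the truncation is removed. *)
Lemma weighted_alternating_sum :
  W x * \sum_(j < K) (-1) ^+ j * phi j x =
  oriented_int alpha (fun t => w t * phi 0 t) x -
  (-1) ^+ K * oriented_int alpha (fun t => w t * phi K t) x.
Proof.
pose d n : R := n.+1%:R^-1.
have d0 n : 0 < d n by rewrite invr_gt0.
have [iw W0 _] := hw.
have lhs : B (d n) x @[n --> \oo] --> W x * \sum_(j < K) (-1) ^+ j * phi j x.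
  rewrite mulr_sumr; apply: cvg_big => [|j _]; first exact: add_continuous.
  rewrite mulrCA; apply: cvgM; first exact: cvg_cst.
  apply: cvgM; last exact: cvg_cst.
  rewrite -[X in _ --> X]mulr1; apply: cvgM; first exact: cvg_cst.
  by apply: cvg_truncation; [rewrite leqW// leq_subr|exact: W0].
have [g ig Hg] := dominating.
have rhs : oriented_int alpha (beta (d n)) x @[n --> \oo] -->
    oriented_int alpha (fun t => w t * phi 0 t - (-1) ^+ K * (w t * phi K t)) x.
  apply: (oriented_int_dominated_cvg (g := g)) => //.
  - by move=> n; exact: mbeta.
  - by apply: measurable_funB => //; exact: measurable_funM.
  - have := weight_ae_neq0; apply: filterS; first exact: (ae_filter_ringOfSetsType mu).
    move=> t Wt xt; have {}Wt := Wt (sub xt).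
    apply: cvgB.
      rewrite -[X in _ --> X]mulr1; apply: cvgM; first exact: cvg_cst.
      exact: cvg_truncation.
    apply: cvgM; first exact: cvg_cst.
    rewrite -[X in _ --> X]mulr1; apply: cvgM; first exact: cvg_cst.
    exact: cvg_truncation.
  - by move=> n t _; exact: Hg.
have E : (fun n => B (d n) x) = (fun n => oriented_int alpha (beta (d n)) x).
  by apply/funext => n; apply: B_oriented; exact: d0.
rewrite E in lhs; rewrite (cvg_unique _ lhs rhs)//.
rewrite /oriented_int.
have ic : mu.-integrable (between alpha x) (EFin \o (fun t => (-1) ^+ K * (w t * phi K t))).
  have mb : @measurable _ (measurableTypeR R) (between alpha x) by exact: measurable_between.
  by have := integrableZl mb ((-1) ^+ K) ihK; exact: eq_integrable.
rewrite RintegralB//; last exact: measurable_between.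
rewrite RintegralZl//; last exact: measurable_between.
by case: ifP => // _; ring.
Qed.

End alternating_sum.

(** * Lower bounds and almost everywhere equality for continuous functions *)

Lemma abs_continuous_away0 {R : realType} (a b : R) f : abs_continuous a b f ->
  (forall x, a <= x <= b -> f x != 0) ->
  exists2 e, 0 < e & forall x, a <= x <= b -> e <= `|f x|.
Proof.
move=> acf f0; have [ab|ba] := leP a b; last first.
  by exists 1 => // x /andP[ax xb]; lra.
apply: (@interval_induction _
  (fun y => exists2 e, 0 < e & forall x, a <= x <= y -> e <= `|f x|) _ _ ab).
  exists `|f a|; first by rewrite normr_gt0 f0 ?lexx.
  by move=> x; rewrite -eq_le => /eqP <-.
move=> c /andP[ac cb].
have fc0 : 0 < `|f c| / 2 by rewrite divr_gt0// normr_gt0 f0 ?ac.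
have [d d0 H] := abs_continuous_dist acf fc0; exists d => //.
move=> u v /andP[au uc] /andP[cv vb] cu vc [e e0 He].
exists (Num.min e (`|f c| / 2)); first by rewrite lt_min e0.
move=> x /andP[ax xv]; rewrite ge_min; have [xu|ux] := leP x u; first by rewrite He ?ax.
apply/orP; right.
have : `|f x - f c| < `|f c| / 2.
  apply: H; rewrite ?ac ?ax ?(le_trans xv)//.
  by rewrite ltr_norml; apply/andP; split; lra.
by have := lerB_dist (f c) (f x); rewrite distrC; lra.
Qed.

(** Continuous functions that differ at a point of an open set differ on a ball, which is not
    null. *)
Lemma continuous_ae_eq {R : realType} (X : set R) (f g : R -> R) : open X ->
  (forall x, X x -> {for x, continuous f}) -> (forall x, X x -> {for x, continuous g}) ->
  ae_eq lebesgue_measure X f g -> forall x, X x -> f x = g x.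
Proof.
move=> oX cf cg fg x Xx; apply/eqP; rewrite -subr_eq0; apply: contrapT => /negP fgx.
have cfg : {for x, continuous (fun y => f y - g y)}.
  by apply: cvgB; [exact: cf|exact: cg].
have d0 : 0 < `|f x - g x| by rewrite normr_gt0.
have /cvgrPdist_lt/(_ _ d0) := cfg.
move=> /nbhs_ballP[r1 /= r10 H1]; have /nbhs_ballP[r2 /= r20 H2] := oX x Xx.
pose r := Num.min r1 r2; have r0 : 0 < r by rewrite lt_min r10.
have : lebesgue_measure.-negligible (ball x r).
  apply: negligibleS fg => y /= xyr.
  have /H1 : ball x r1 y by move: xyr; rewrite /ball /= lt_min => /andP[].
  have /H2 Xy : ball x r2 y by move: xyr; rewrite /ball /= lt_min => /andP[].
  by move=> + /(_ Xy) E; rewrite E subrr subr0 ltxx.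
move=> nb; have b0 := (negligibleP lebesgue_measure (measurable_ball x r)).1 nb.
have : lebesgue_measure (ball x r) = 0%E := b0.
by rewrite lebesgue_measure_ball ?ltW// => /eqP; rewrite eqe mulrn_eq0 /= gt_eqF.
Qed.

(** * Iterated weighted derivatives of Hardy means *)

Section weighted_derivation.
Context {R : realType} (alpha : \bar R) (w : R -> R).
Implicit Types (X : set R) (f g h : R -> R) (k : nat).
Notation mu := (@lebesgue_measure R).
Notation W := (primitive1 alpha w).

(** The final almost everywhere equality is absorbed by taking [g] itself as last function, since
    [is_wdiff] fixes its second function only up to a null set. This takes at least one
    derivation. *)
Lemma is_wdiffn_chain X k f g : is_wdiffn alpha w X k.+1 f g ->
  exists phi : nat -> R -> R, [/\ phi 0 = f, phi k.+1 = g &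
    forall j, (j < k.+1)%N -> is_wdiff alpha w X (phi j) (phi j.+1)].
Proof.
elim: k f => [|k IH] f [h [acf dfh] hg].
  exists (fun j => if j is 0 then f else g); split=> // -[|//] _; split=> //.
  move: dfh hg; apply: filterS2; first exact: (ae_filter_ringOfSetsType mu).
  by move=> x dfh hg Xx; have [? <-] := dfh Xx; rewrite hg.
have [phi [phi0 phik dphi]] := IH h hg.
exists (fun j => if j is i.+1 then phi i else f); split=> // -[|j].
  by rewrite phi0.
exact: dphi.
Qed.

Lemma chain_is_wdiffn X k (psi : nat -> R -> R) h :
  (forall j, (j < k)%N -> is_wdiff alpha w X (psi j) (psi j.+1)) ->
  ae_eq mu X (psi k) h -> is_wdiffn alpha w X k (psi 0) h.
Proof.
elim: k psi => [//|k IH] psi dpsi psih; exists (psi 1); first exact: dpsi.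
by apply: (IH (fun j => psi j.+1)) => // j jk; exact: dpsi.
Qed.

(** Continuous representatives equal almost everywhere agree on the open set [X], hence so do their
    derivatives, and the argument repeats. *)
Lemma is_wdiffn_unique X k f f' g g' : open X -> ae_eq mu X f f' ->
  is_wdiffn alpha w X k f g -> is_wdiffn alpha w X k f' g' -> ae_eq mu X g g'.
Proof.
move=> oX; elim: k f f' => [|k IH] f f' ff'.
  by move=> fg f'g'; apply: ae_eq_trans f'g'; apply: ae_eq_trans ff'; exact: ae_eq_sym.
move=> [h [acf dfh] hg] [h' [acf' dfh'] hg']; apply: IH hg hg'.
have E : forall x, X x -> f x = f' x.
  apply: continuous_ae_eq => // x Xx.
    exact: locally_abs_continuous_continuous acf Xx.
  exact: locally_abs_continuous_continuous acf' Xx.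
move: dfh dfh'; apply: filterS2; first exact: (ae_filter_ringOfSetsType mu).
move=> x dfh dfh' Xx; have [_ ->] := dfh Xx; have [_ ->] := dfh' Xx.
congr (_ * _); rewrite !derive1E; apply: near_eq_derive.
by have := oX x Xx; apply: filterS => y; exact: E.
Qed.

Hypothesis hw : weight alpha w.

(** Quotient rule: with [F] the oriented integral of [w f], [(W / w) (F / W)' = f - F / W]. *)
Lemma hardy_is_wdiff f : hardy_domain alpha w f ->
  locally_abs_continuous (target alpha) (hardy alpha w f) /\
  {ae mu, forall x, target alpha x ->
    exists2 c, is_derive x 1 (hardy alpha w f) c & W x / w x * c = f x - hardy alpha w f x}.
Proof.
move=> hf; have [iw W0 w0] := hw.
have hf' := source_integrable hf.
have acW := weight_locally_abs_continuous hw.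
have acF := locally_abs_continuous_oriented_int (@source_neq _ _) hf'.
split.
  move=> a b abt; have abs := subset_trans abt (@subset_target_source _ _).
  have [e e0 He] := abs_continuous_away0 (acW a b abs) (fun x xab => W0 x (abt x xab)).
  apply: abs_continuousM; last exact: acF.
  by apply: (abs_continuousV e0) => //; exact: acW.
have := is_derive_oriented_int (@source_neq _ _) hf' (@open_source _ _).
move: w0 (weight_is_derive hw); apply: filterS3; first exact: (ae_filter_ringOfSetsType mu).
move=> x w0 dW dF tx; have sx := subset_target_source tx.
have {}w0 := w0 sx; have {}dW := dW sx; have {}dF := dF sx.
have Wx0 := W0 x tx.
eexists; first exact: (is_deriveM (is_deriveV Wx0 dW) dF).
rewrite /hardy /GRing.scale /=; field.
by rewrite Wx0.
Qed.

Variables (K : nat) (phi : nat -> R -> R).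
Hypothesis dphi : forall j, (j < K)%N ->
  is_wdiff alpha w (source alpha) (phi j) (phi j.+1).
Hypothesis i0 : hardy_domain alpha w (phi 0).
Hypothesis iK : hardy_domain alpha w (phi K).

Let psi j t := (-1) ^+ j * (hardy alpha w (phi 0) t - \sum_(i < j) (-1) ^+ i * phi i t).

(** The derivation turns [H f] into [phi 0 - H f] and shifts the sum by one index; [phi 0] becomes
    its new first term. *)
Lemma is_wdiff_hardy_remainder j : (j < K)%N ->
  is_wdiff alpha w (target alpha) (psi j) (psi j.+1).
Proof.
move=> jK; have [acH dH] := hardy_is_wdiff i0; split.
  move=> a b abt; have abs := subset_trans abt (@subset_target_source _ _).
  apply: abs_continuousZ; apply: abs_continuousB; first exact: acH.
  apply: (@abs_continuous_sum _ _ _ j (fun i t => (-1) ^+ i * phi i t)) => i ij.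
  by apply: abs_continuousZ; have [+ _] := dphi (ltn_trans ij jK); apply.
have dall : {ae mu, forall t (i : nat), (i < K)%N -> source alpha t ->
    derivable (phi i) t 1 /\ phi i.+1 t = W t / w t * derive1 (phi i) t}.
  apply: ae_foralln => i; have [iK'|iK'] := ltnP i K; last by apply: aeW.
  have [_] := dphi iK'; apply: filterS; first exact: (ae_filter_ringOfSetsType mu).
  by move=> t H _; exact: H.
move: dall dH; apply: filterS2; first exact: (ae_filter_ringOfSetsType mu).
move=> x dall dH tx; have sx := subset_target_source tx.
have [c dc Ec] := dH tx.
have dterm (i : 'I_j) :
    is_derive x 1 ((fun=> (-1) ^+ i : R) * phi i) ((-1) ^+ i * derive1 (phi i) x).
  have [di _] := dall i (ltn_trans (ltn_ord i) jK) sx.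
  apply: (is_derive_eq (is_deriveM (is_derive_cst _ _ _) (derivableP di))).
  by rewrite /GRing.scale /= mulr0 addr0 derive1E.
have dpsi := is_deriveM (is_derive_cst ((-1) ^+ j : R) x (1 : R))
  (is_deriveB dc (is_derive_sum dterm)).
have psiE : psi j = (fun=> (-1) ^+ j) *
    (hardy alpha w (phi 0) - \sum_(i < j) ((fun=> (-1) ^+ i : R) * phi i)).
  apply/funext => t; rewrite /psi /=; congr (_ * (_ - _)).
  by rewrite fct_sumE.
rewrite -psiE in dpsi; split; first exact: ex_derive.
rewrite derive1E (derive_val (is_derive := dpsi)) /GRing.scale /= mulr0 addr0.
rewrite mulrCA mulrBr Ec /psi exprS mulN1r mulNr -mulrN; congr (_ * _).
rewrite big_ord_recl /= expr0 mul1r mulr_sumr opprB.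
have -> : \sum_(i < j) (-1) ^+ bump 0 i * phi (bump 0 i) x =
  - \sum_(i < j) W x / w x * ((-1) ^+ i * derive1 (phi i) x).
  rewrite -sumrN; apply: eq_bigr => i _; rewrite /bump /= add1n.
  have [_ ->] := dall i (ltn_trans (ltn_ord i) jK) sx.
  by rewrite exprS; ring.
ring.
Qed.

(** After division by [W x], the alternating sum identity cancels the integral of [w phi_0] and
    leaves that of [w phi_K] with sign [(-1)^K] squared. *)
Lemma hardy_remainderE x : target alpha x -> psi K x = hardy alpha w (phi K) x.
Proof.
move=> tx; have [_ W0 _] := hw.
have E := weighted_alternating_sum hw dphi i0 iK tx; have Wx := W0 x tx.
rewrite /psi /hardy.
have -> : \sum_(i < K) (-1) ^+ i * phi i x =
    (W x)^-1 * (W x * \sum_(j < K) (-1) ^+ j * phi j x).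
  by rewrite mulKf.
rewrite E -mulrBr subKr mulrCA; congr (_ * _).
by rewrite mulrA -expr2 sqrr_sign mul1r.
Qed.

End weighted_derivation.

(* If D_k f = g, then D_k (H f) is defined and equal to H g. *)
Theorem theorem2p1 (R : realType) (alpha : \bar R) (w : R -> R) (k : nat)
    (hk : (0 < k)%N) (hw : weight alpha w) (f g : R -> R)
    (hf : hardy_domain alpha w f)
    (hfg : is_wdiffn alpha w (source alpha) k f g)
    (hg : hardy_domain alpha w g) (h : R -> R) :
  is_wdiffn alpha w (target alpha) k (hardy alpha w f) h <->
  ae_eq lebesgue_measure (target alpha) (hardy alpha w g) h.
Proof.
case: k hk hfg => // k _ /is_wdiffn_chain[phi [phi0 phik dphi]].
have i0 : hardy_domain alpha w (phi 0) by rewrite phi0.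
have ik : hardy_domain alpha w (phi k.+1) by rewrite phik.
have exist h' : ae_eq lebesgue_measure (target alpha) (hardy alpha w g) h' ->
    is_wdiffn alpha w (target alpha) k.+1 (hardy alpha w f) h'.
  move=> gh'.
  have := @chain_is_wdiffn _ alpha w (target alpha) k.+1
    (fun j t => (-1) ^+ j * (hardy alpha w (phi 0) t - \sum_(i < j) (-1) ^+ i * phi i t)) h'.
  rewrite [X in is_wdiffn _ _ _ _ X](_ : _ = hardy alpha w f); last first.
    by apply/funext => t; rewrite expr0 mul1r big_ord0 subr0 phi0.
  apply; first exact: is_wdiff_hardy_remainder.
  apply: ae_eq_trans gh'; apply: aeW => x tx.
  by rewrite (hardy_remainderE hw dphi i0 ik tx) phik.
split=> [fh|]; last exact: exist.
(* [H g] is itself an iterated derivative of [H f], so any other one agrees with it almost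
   everywhere. *)
apply: is_wdiffn_unique fh; [exact: open_target|exact: ae_eq_refl|].
exact: exist (ae_eq_refl _ _ _).
Qed.
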